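(* Let $N\in\mathbb N$, $N\ge 2$, and let $f_0\in\mathcal A_u(B_{\ell_2})$ be given by $f_0(x)=\sum_{j=1}^\infty x_j^N$. Let $g\in\mathcal H^\infty(B_{\ell_2},\ell_2)$ with $\|g\|=1$ and $g(B_{\ell_2})\subset B_{\ell_2}$ be such that (1) $\|g(0)\|+\|g-g(0)\|\le 1$; (2) there exists a linear transformation $P:\ell_2\to\ell_2$ with $\|P\|\le 1$ and non-trivial kernel such that $g=g\circ P$ on $B_{\ell_2}$. Then the vector-valued cluster set $\mathcal{C\ell}(f_0,g)$ contains an analytic copy of the open unit ball $B_{\mathcal H^\infty(B_{\ell_2})}$ of $\mathcal H^\infty(B_{\ell_2})$.
   Context: All spaces are complex and $B_{\ell_2}$ is the open unit ball of $\ell_2$. $\mathcal A_u(B_{\ell_2})$ is the Banach algebra (sup norm) of holomorphic functions $f:B_{\ell_2}\to\mathbb C$ that are uniformly continuous on $B_{\ell_2}$. $\mathcal H^\infty(B_{\ell_2})$ is the Banach algebra of bounded holomorphic functions $B_{\ell_2}\to\mathbb C$ with the sup norm; $\mathcal H^\infty(B_{\ell_2},\ell_2)$ is the Banach space of bounded holomorphic maps $B_{\ell_2}\to\ell_2$ with the sup norm, and $B_{\mathcal H^\infty(B_{\ell_2},\ell_2)}$ is its open unit ball. In $\|g-g(0)\|$, $g(0)$ is viewed as a constant function; $\|P\|$ is the operator norm. Vector-valued cluster set: for $f\in\mathcal A_u(B_{\ell_2})$ and $g$ in the closed unit ball of $\mathcal H^\infty(B_{\ell_2},\ell_2)$, $\mathcal{C\ell}(f,g)$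 is the set of all $h\in\mathcal H^\infty(B_{\ell_2})$ for which there is a net $(g_\alpha)\subset B_{\mathcal H^\infty(B_{\ell_2},\ell_2)}$ with $g_\alpha\xrightarrow{w^*}g$ and $f(g_\alpha(y))\to h(y)$ for all $y\in B_{\ell_2}$. Here $g_\alpha\xrightarrow{w^*}g$ (weak-star convergence in $\mathcal H^\infty(B_{\ell_2},\ell_2)$ as a dual space) means, for such nets in the unit ball, that $\langle g_\alpha(y),v\rangle\to\langle g(y),v\rangle$ for all $y\in B_{\ell_2}$ and $v\in\ell_2$. For an open subset $U$ of a complex Banach space, $\mathcal{C\ell}(f,g)$ contains an analytic copy of $U$ if there is an injective map $F:U\to\mathcal H^\infty(B_{\ell_2})$ with $F(U)\subset\mathcal{C\ell}(f,g)$ such that $u\mapsto F(u)(x)$ is holomorphic on $U$ for every $x\in B_{\ell_2}$. *)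

(* Defs.v *)
From Stdlib Require Import Reals Lra Lia.
From Stdlib Require Import FunctionalExtensionality ProofIrrelevance.
From Coquelicot Require Import Coquelicot.

Open Scope R_scope.

(** Coquelicot's [NormedModule] carries a uniform structure; here it is the
    one whose balls are the balls of the given norm. *)

Section NormBalls.
Context {K : AbsRing} {V : ModuleSpace K} (n : V -> R)
  (n_triangle : forall x y : V, n (plus x y) <= n x + n y)
  (n_scal : forall (k : K) (x : V), n (scal k x) <= abs k * n x).

Lemma n_zero_le : n zero <= 0.
Proof using n_scal.
assert (H := n_scal zero zero).
replace (scal (zero : K) (zero : V)) with (zero : V) in H
  by (symmetry; apply @scal_zero_l).
replace (abs (zero : K)) with 0 in H by (symmetry; apply abs_zero).
lra.
Qed.

Lemma n_opp_le (x : V) : n (opp x) <= n x.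
Proof using n_scal.
assert (H := n_scal (opp one) x).
replace (scal (opp one : K) x) with (opp x) in H
  by (symmetry; apply @scal_opp_one).
replace (abs (opp one : K)) with 1 in H by (symmetry; apply abs_opp_one).
lra.
Qed.

Lemma norm_ball_center (x : V) (e : posreal) : n (minus x x) < e.
Proof using n_scal.
rewrite minus_eq_zero; apply Rle_lt_trans with (1 := n_zero_le), cond_pos.
Qed.

Lemma norm_ball_sym (x y : V) (e : R) : n (minus y x) < e -> n (minus x y) < e.
Proof using n_scal.
intros H; rewrite <- opp_minus.
apply Rle_lt_trans with (1 := n_opp_le _), H.
Qed.

Lemma norm_ball_triangle (x y z : V) (e1 e2 : R) :
  n (minus y x) < e1 -> n (minus z y) < e2 -> n (minus z x) < e1 + e2.
Proof using n_triangle.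
intros H1 H2; rewrite (minus_trans y).
eapply Rle_lt_trans; [apply n_triangle|]; lra.
Qed.

Definition norm_uniform_mixin : UniformSpace.mixin_of V :=
  UniformSpace.Mixin V zero (fun x e y => n (minus y x) < e)
    norm_ball_center norm_ball_sym norm_ball_triangle.

Lemma norm_ball_refine (x y : V) (e : R) :
  n (minus y x) < e -> n (minus y x) < e.
Proof. easy. Qed.

Lemma norm_ball_factor (x y : V) (e : posreal) :
  n (minus y x) < e -> n (minus y x) < 1 * e.
Proof. now rewrite Rmult_1_l. Qed.

End NormBalls.

(** Complex l2; coordinates are indexed from 0. *)

Record l2 : Type := mk_l2 {
  l2_coord :> nat -> C;
  l2_summable : ex_series (fun j => Cmod (l2_coord j) ^ 2)
}.

Lemma l2_ext (x y : l2) : (forall j, x j = y j) -> x = y.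
Proof.
destruct x as [x hx], y as [y hy]; simpl; intros H.
apply functional_extensionality in H; subst y.
f_equal; apply proof_irrelevance.
Qed.

Lemma ex_series_le_pos (a b : nat -> R) :
  (forall j, 0 <= a j <= b j) -> ex_series b -> ex_series a.
Proof.
intros H; apply (ex_series_le (K := R_AbsRing) (V := R_CompleteNormedModule)).
intros j; change (Rabs (a j) <= b j).
rewrite Rabs_pos_eq; apply H.
Qed.

Lemma Cmod_plus_sqr (t : R) (a b : C) : 0 < t ->
  Cmod (a + b)%C ^ 2 <= (1 + t) * Cmod a ^ 2 + (1 + / t) * Cmod b ^ 2.
Proof.
intros Ht.
assert (H := Cmod_triangle a b).
assert (H0 := Cmod_ge_0 (a + b)%C).
apply Rle_trans with ((Cmod a + Cmod b) ^ 2).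
{ apply pow_incr; lra. }
assert (E : (1 + t) * Cmod a ^ 2 + (1 + / t) * Cmod b ^ 2 -
  (Cmod a + Cmod b) ^ 2 = / t * (t * Cmod a - Cmod b) ^ 2) by (field; lra).
assert (0 <= / t * (t * Cmod a - Cmod b) ^ 2).
{ apply Rmult_le_pos; [left; now apply Rinv_0_lt_compat | apply pow2_ge_0]. }
lra.
Qed.

Lemma ex_series_lin (c d : R) (x y : l2) :
  ex_series (fun j => c * Cmod (x j) ^ 2 + d * Cmod (y j) ^ 2).
Proof.
apply (ex_series_plus (fun j => c * Cmod (x j) ^ 2) (fun j => d * Cmod (y j) ^ 2)).
- exact (ex_series_scal c _ (l2_summable x)).
- exact (ex_series_scal d _ (l2_summable y)).
Qed.

Lemma l2_plus_summable (x y : l2) :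
  ex_series (fun j => Cmod (x j + y j)%C ^ 2).
Proof.
apply ex_series_le_pos with (2 := ex_series_lin (1 + 1) (1 + / 1) x y).
intros j; split; [apply pow2_ge_0 | apply Cmod_plus_sqr; lra].
Qed.

Lemma l2_scal_summable (k : C) (x : l2) :
  ex_series (fun j => Cmod (k * x j)%C ^ 2).
Proof.
apply ex_series_ext with (fun j => Cmod k ^ 2 * Cmod (x j) ^ 2).
- now intros j; rewrite Cmod_mult, Rpow_mult_distr.
- exact (ex_series_scal (Cmod k ^ 2) _ (l2_summable x)).
Qed.

Lemma l2_opp_summable (x : l2) : ex_series (fun j => Cmod (- x j)%C ^ 2).
Proof.
apply ex_series_ext with (2 := l2_summable x).
now intros j; rewrite Cmod_opp.
Qed.

Lemma l2_zero_summable : ex_series (fun _ : nat => Cmod (RtoC 0) ^ 2).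
Proof.
exists 0; apply (is_series_ext (fun _ => 0)).
- intros _; rewrite Cmod_0; symmetry; apply pow_ne_zero; discriminate.
- apply filterlim_ext with (fun _ : nat => 0).
  + intros m; rewrite sum_n_const; symmetry; apply Rmult_0_r.
  + apply filterlim_const.
Qed.

Definition l2_plus (x y : l2) : l2 := mk_l2 _ (l2_plus_summable x y).
Definition l2_scal (k : C) (x : l2) : l2 := mk_l2 _ (l2_scal_summable k x).
Definition l2_opp (x : l2) : l2 := mk_l2 _ (l2_opp_summable x).
Definition l2_zero : l2 := mk_l2 _ l2_zero_summable.
Definition l2_norm (x : l2) : R := sqrt (Series (fun j => Cmod (x j) ^ 2)).

Lemma l2_plus_comm (x y : l2) : l2_plus x y = l2_plus y x.
Proof. apply l2_ext; intros j; apply Cplus_comm. Qed.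

Lemma l2_plus_assoc (x y z : l2) :
  l2_plus x (l2_plus y z) = l2_plus (l2_plus x y) z.
Proof. apply l2_ext; intros j; apply Cplus_assoc. Qed.

Lemma l2_plus_zero (x : l2) : l2_plus x l2_zero = x.
Proof. apply l2_ext; intros j; apply Cplus_0_r. Qed.

Lemma l2_plus_opp (x : l2) : l2_plus x (l2_opp x) = l2_zero.
Proof. apply l2_ext; intros j; apply Cplus_opp_r. Qed.

Canonical l2_AbelianMonoid : AbelianMonoid :=
  AbelianMonoid.Pack l2 (AbelianMonoid.Mixin l2 l2_plus l2_zero
    l2_plus_comm l2_plus_assoc l2_plus_zero) l2.

Canonical l2_AbelianGroup : AbelianGroup :=
  AbelianGroup.Pack l2 (AbelianGroup.Class l2 _
    (AbelianGroup.Mixin l2_AbelianMonoid l2_opp l2_plus_opp)) l2.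

Lemma l2_scal_assoc (a b : C_Ring) (x : l2) :
  l2_scal a (l2_scal b x) = l2_scal (mult a b) x.
Proof. apply l2_ext; intros j; apply Cmult_assoc. Qed.

Lemma l2_scal_one (x : l2) : l2_scal (one : C_Ring) x = x.
Proof. apply l2_ext; intros j; apply Cmult_1_l. Qed.

Lemma l2_scal_plus_l (a : C_Ring) (x y : l2_AbelianGroup) :
  l2_scal a (plus x y) = plus (l2_scal a x : l2_AbelianGroup) (l2_scal a y).
Proof. apply l2_ext; intros j; apply Cmult_plus_distr_l. Qed.

Lemma l2_scal_plus_r (a b : C_Ring) (x : l2_AbelianGroup) :
  l2_scal (plus a b) x = plus (l2_scal a x : l2_AbelianGroup) (l2_scal b x).
Proof. apply l2_ext; intros j; apply Cmult_plus_distr_r. Qed.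

Canonical l2_ModuleSpace : ModuleSpace C_Ring :=
  ModuleSpace.Pack C_Ring l2 (ModuleSpace.Class C_Ring l2 _
    (ModuleSpace.Mixin C_Ring l2_AbelianGroup l2_scal
       l2_scal_assoc l2_scal_one l2_scal_plus_l l2_scal_plus_r)) l2.

Lemma l2_norm_ge_0 (x : l2) : 0 <= l2_norm x.
Proof. apply sqrt_pos. Qed.

Lemma Series_l2_ge_0 (x : l2) : 0 <= Series (fun j => Cmod (x j) ^ 2).
Proof.
replace 0 with (Series (fun j => 0 * Cmod (x j) ^ 2)).
- apply Series_le; [|exact (l2_summable x)].
  intros j; assert (H := pow2_ge_0 (Cmod (x j))); lra.
- rewrite Series_scal_l; ring.
Qed.

Lemma l2_norm_sqr (x : l2) : l2_norm x ^ 2 = Series (fun j => Cmod (x j) ^ 2).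
Proof. apply pow2_sqrt, Series_l2_ge_0. Qed.

Lemma l2_norm_triangle (x y : l2) :
  l2_norm (l2_plus x y) <= l2_norm x + l2_norm y.
Proof.
apply le_epsilon; intros e He.
assert (Hx := l2_norm_ge_0 x); assert (Hy := l2_norm_ge_0 y).
set (X := l2_norm x + e / 2); set (Y := l2_norm y + e / 2).
assert (HX : 0 < X) by (unfold X; lra).
assert (HY : 0 < Y) by (unfold Y; lra).
replace (l2_norm x + l2_norm y + e) with (X + Y) by (unfold X, Y; field).
apply Rsqr_incr_0_var; [|lra].
rewrite !Rsqr_pow2, l2_norm_sqr.
apply Rle_trans with (Series (fun j =>
  (1 + Y / X) * Cmod (x j) ^ 2 + (1 + / (Y / X)) * Cmod (y j) ^ 2)).
{ apply Series_le; [|apply ex_series_lin].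
  intros j; split; [apply pow2_ge_0|].
  apply Cmod_plus_sqr, Rdiv_lt_0_compat; assumption. }
rewrite Series_plus.
2: exact (ex_series_scal (1 + Y / X) _ (l2_summable x)).
2: exact (ex_series_scal (1 + / (Y / X)) _ (l2_summable y)).
rewrite !Series_scal_l, <- !l2_norm_sqr.
replace ((X + Y) ^ 2) with ((1 + Y / X) * X ^ 2 + (1 + / (Y / X)) * Y ^ 2)
  by (field; lra).
assert (0 < Y / X) by now apply Rdiv_lt_0_compat.
assert (0 < / (Y / X)) by now apply Rinv_0_lt_compat.
apply Rplus_le_compat; (apply Rmult_le_compat_l; [lra|]);
  apply pow_incr; unfold X, Y; lra.
Qed.

Lemma l2_norm_scal (k : C) (x : l2) :
  l2_norm (l2_scal k x) <= Cmod k * l2_norm x.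
Proof.
right; unfold l2_norm.
rewrite <- (sqrt_pow2 (Cmod k)) by apply Cmod_ge_0.
rewrite <- sqrt_mult_alt by apply pow2_ge_0.
f_equal; rewrite <- Series_scal_l; apply Series_ext; intros j.
now simpl l2_coord; rewrite Cmod_mult, Rpow_mult_distr.
Qed.

Lemma Series_pos_eq_0 (a : nat -> R) :
  (forall j, 0 <= a j) -> ex_series a -> Series a = 0 -> forall j, a j = 0.
Proof.
intros Ha Ea Sa j.
apply Rle_antisym; [|apply Ha].
rewrite <- Sa, (Series_incr_n a (S j)) by (trivial; lia).
assert (H1 : a j <= sum_f_R0 a (pred (S j))).
{ simpl; destruct j as [|j]; simpl; [lra|].
  assert (0 <= sum_f_R0 a j) by now apply cond_pos_sum.
  lra. }
assert (H2 : 0 <= Series (fun i => a (S j + i)%nat)).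
{ replace 0 with (Series (fun i => 0 * a (S j + i)%nat))
    by (rewrite Series_scal_l; ring).
  apply Series_le; [|now apply (ex_series_incr_n a (S j))].
  intros i; assert (H := Ha (S j + i)%nat); lra. }
lra.
Qed.

Lemma l2_norm_eq_0 (x : l2) : l2_norm x = 0 -> x = l2_zero.
Proof.
intros H; apply l2_ext; intros j; apply Cmod_eq_0.
assert (E : Cmod (x j) ^ 2 = 0).
{ apply (Series_pos_eq_0 (fun j => Cmod (x j) ^ 2)).
  - intros i; apply pow2_ge_0.
  - exact (l2_summable x).
  - rewrite <- l2_norm_sqr, H; ring. }
now apply Rsqr_0_uniq; rewrite Rsqr_pow2.
Qed.

Definition l2_uniform_mixin : UniformSpace.mixin_of l2 :=
  @norm_uniform_mixin C_AbsRing l2_ModuleSpace l2_norm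
    l2_norm_triangle l2_norm_scal.

Canonical l2_UniformSpace : UniformSpace :=
  UniformSpace.Pack l2 l2_uniform_mixin l2.

Canonical l2_NormedModuleAux : NormedModuleAux C_AbsRing :=
  NormedModuleAux.Pack C_AbsRing l2 (NormedModuleAux.Class C_AbsRing l2
    (ModuleSpace.class C_Ring l2_ModuleSpace) l2_uniform_mixin) l2.

Definition l2_normed_mixin : NormedModule.mixin_of C_AbsRing l2_NormedModuleAux :=
  NormedModule.Mixin C_AbsRing l2_NormedModuleAux l2_norm 1
    l2_norm_triangle l2_norm_scal
    (@norm_ball_refine C_AbsRing l2_ModuleSpace l2_norm)
    (@norm_ball_factor C_AbsRing l2_ModuleSpace l2_norm)
    l2_norm_eq_0.

Canonical l2_NormedModule : NormedModule C_AbsRing :=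
  NormedModule.Pack C_AbsRing l2 (NormedModule.Class C_AbsRing l2
    (NormedModuleAux.class C_AbsRing l2_NormedModuleAux) l2_normed_mixin) l2.

(** Sum of a complex series: Coquelicot's [Series] is real-valued. *)
Definition CSeries (a : nat -> C) : C :=
  (Series (fun j => Re (a j)), Series (fun j => Im (a j))).

Definition l2_inner (x v : l2) : C := CSeries (fun j => (x j * Cconj (v j))%C).

Definition open_unit_ball {V : NormedModule C_AbsRing} (x : V) : Prop :=
  norm x < 1.

(** Complex Frechet differentiability at every point of [U]; the differential
    required by [ex_filterdiff] is complex-linear and bounded. *)
Definition holomorphic_on {V W : NormedModule C_AbsRing}
    (U : V -> Prop) (f : V -> W) : Prop :=
  forall x, U x -> ex_filterdiff f (locally x).

Definition uniformly_continuous_on {V W : NormedModule C_AbsRing}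
    (U : V -> Prop) (f : V -> W) : Prop :=
  forall eps : posreal, exists delta : posreal, forall x y, U x -> U y ->
    norm (minus x y) < delta -> norm (minus (f x) (f y)) < eps.

(** Membership in A_u(B_{l2}) of the restriction of [f] to the open ball. *)
Definition Au (f : l2 -> C) : Prop :=
  holomorphic_on (V := l2_NormedModule) (W := C_NormedModule) open_unit_ball f /\
  uniformly_continuous_on (V := l2_NormedModule) (W := C_NormedModule)
    open_unit_ball f.

(** A map defined on the open unit ball of [V] is represented by its extension
    by zero to [V], so that equality in [Hinf V W] is equality of the maps on
    the ball. *)

Record Hinf (V W : NormedModule C_AbsRing) : Type := mk_Hinf {
  Hinf_fun :> V -> W;
  Hinf_holo : holomorphic_on open_unit_ball Hinf_fun;
  Hinf_bounded : exists M : R, forall x, open_unit_ball x -> norm (Hinf_fun x) <= M;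
  Hinf_out : forall x, ~ open_unit_ball x -> Hinf_fun x = zero
}.

Arguments mk_Hinf {V W} Hinf_fun Hinf_holo Hinf_bounded Hinf_out.
Arguments Hinf_fun {V W} h x.
Arguments Hinf_holo {V W} h x Hx.
Arguments Hinf_bounded {V W} h.
Arguments Hinf_out {V W} h x Hx.

Lemma plus_minus {G : AbelianGroup} (x y : G) : y = plus x (minus y x).
Proof.
rewrite (plus_comm x); unfold minus; rewrite <- plus_assoc.
transitivity (plus y (zero : G)); [symmetry; apply plus_zero_r|].
f_equal; symmetry; exact (plus_opp_l x).
Qed.

Section HinfSpace.
Context {V W : NormedModule C_AbsRing}.
Implicit Types f g h : Hinf V W.

Lemma Hinf_ext f g : (forall x, open_unit_ball x -> f x = g x) -> f = g.
Proof.
intros H.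
assert (E : Hinf_fun f = Hinf_fun g).
{ apply functional_extensionality; intros x.
  destruct (Rlt_dec (norm x) 1) as [Hx|Hx]; [now apply H|].
  now rewrite !Hinf_out. }
destruct f as [f f1 f2 f3], g as [g g1 g2 g3]; simpl in E; subst g.
f_equal; apply proof_irrelevance.
Qed.

Lemma zero_in_ball : open_unit_ball (zero : V).
Proof. unfold open_unit_ball; rewrite norm_zero; lra. Qed.

Lemma locally_open_unit_ball (x : V) :
  open_unit_ball x -> locally x open_unit_ball.
Proof.
intros Hx; unfold open_unit_ball in *.
assert (He : 0 < 1 - norm x) by lra.
apply locally_le_locally_norm.
exists (mkposreal _ He); intros y Hy; unfold ball_norm in Hy; simpl in Hy.
replace y with (plus x (minus y x)).
- eapply Rle_lt_trans; [apply norm_triangle|]; lra.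
- symmetry; apply (plus_minus (G := V)).
Qed.

Lemma Hinf_plus_holo f g :
  holomorphic_on open_unit_ball (fun x => plus (f x) (g x)).
Proof.
intros x Hx.
destruct (Hinf_holo f x Hx) as [lf Hf], (Hinf_holo g x Hx) as [lg Hg].
eexists; apply filterdiff_plus_fct; eassumption.
Qed.

Lemma Hinf_plus_bounded f g : exists M : R,
  forall x, open_unit_ball x -> norm (plus (f x) (g x)) <= M.
Proof.
destruct (Hinf_bounded f) as [M HM], (Hinf_bounded g) as [M' HM'].
exists (M + M'); intros x Hx.
eapply Rle_trans; [apply norm_triangle|].
now apply Rplus_le_compat; [apply HM | apply HM'].
Qed.

Lemma Hinf_plus_out f g x :
  ~ open_unit_ball x -> plus (f x) (g x) = zero.
Proof. intros Hx; rewrite !Hinf_out by easy; apply plus_zero_r. Qed.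

Definition Hinf_plus f g : Hinf V W :=
  mk_Hinf _ (Hinf_plus_holo f g) (Hinf_plus_bounded f g) (Hinf_plus_out f g).

Lemma Hinf_scal_holo (k : C) f :
  holomorphic_on open_unit_ball (fun x => scal (k : C_AbsRing) (f x)).
Proof.
intros x Hx; destruct (Hinf_holo f x Hx) as [lf Hf].
eexists; apply filterdiff_scal_r_fct; [exact Cmult_comm | eassumption].
Qed.

Lemma Hinf_scal_bounded (k : C) f : exists M : R,
  forall x, open_unit_ball x -> norm (scal (k : C_AbsRing) (f x)) <= M.
Proof.
destruct (Hinf_bounded f) as [M HM].
exists (Cmod k * M); intros x Hx.
eapply Rle_trans; [apply norm_scal|].
now apply Rmult_le_compat_l; [apply Cmod_ge_0 | apply HM].
Qed.

Lemma Hinf_scal_out (k : C) f x :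
  ~ open_unit_ball x -> scal (k : C_AbsRing) (f x) = zero.
Proof. intros Hx; rewrite Hinf_out by easy; apply @scal_zero_r. Qed.

Definition Hinf_scal (k : C) f : Hinf V W :=
  mk_Hinf _ (Hinf_scal_holo k f) (Hinf_scal_bounded k f) (Hinf_scal_out k f).

Lemma Hinf_opp_holo f :
  holomorphic_on open_unit_ball (fun x => opp (f x)).
Proof.
intros x Hx; destruct (Hinf_holo f x Hx) as [lf Hf].
eexists; apply filterdiff_opp_fct; eassumption.
Qed.

Lemma Hinf_opp_bounded f : exists M : R,
  forall x, open_unit_ball x -> norm (opp (f x)) <= M.
Proof.
destruct (Hinf_bounded f) as [M HM].
exists M; intros x Hx; rewrite norm_opp; now apply HM.
Qed.

Lemma Hinf_opp_out f x : ~ open_unit_ball x -> opp (f x) = zero.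
Proof. intros Hx; rewrite Hinf_out by easy; exact (@opp_zero W). Qed.

Definition Hinf_opp f : Hinf V W :=
  mk_Hinf _ (Hinf_opp_holo f) (Hinf_opp_bounded f) (Hinf_opp_out f).

Definition const_on_ball (w : W) (x : V) : W :=
  if Rlt_dec (norm x) 1 then w else zero.

Lemma const_on_ball_in (w : W) x : open_unit_ball x -> const_on_ball w x = w.
Proof. unfold const_on_ball; now destruct Rlt_dec. Qed.

Lemma const_on_ball_out (w : W) x :
  ~ open_unit_ball x -> const_on_ball w x = zero.
Proof. unfold const_on_ball; now destruct Rlt_dec. Qed.

Lemma const_on_ball_holo (w : W) :
  holomorphic_on open_unit_ball (const_on_ball w).
Proof.
intros x Hx; apply ex_filterdiff_ext_locally with (fun _ => w).
- apply filter_imp with (2 := locally_open_unit_ball x Hx).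
  intros y Hy; symmetry; now apply const_on_ball_in.
- eexists; apply filterdiff_const.
Qed.

Lemma const_on_ball_bounded (w : W) : exists M : R,
  forall x, open_unit_ball x -> norm (const_on_ball w x) <= M.
Proof.
exists (norm w); intros x Hx; rewrite const_on_ball_in by easy; lra.
Qed.

Definition Hinf_const (w : W) : Hinf V W :=
  mk_Hinf (const_on_ball w) (const_on_ball_holo w) (const_on_ball_bounded w)
    (const_on_ball_out w).

Lemma Hinf_plus_comm f g : Hinf_plus f g = Hinf_plus g f.
Proof. apply Hinf_ext; intros x _; apply plus_comm. Qed.

Lemma Hinf_plus_assoc f g h :
  Hinf_plus f (Hinf_plus g h) = Hinf_plus (Hinf_plus f g) h.
Proof. apply Hinf_ext; intros x _; apply plus_assoc. Qed.

Lemma Hinf_plus_zero f : Hinf_plus f (Hinf_const zero) = f.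
Proof.
apply Hinf_ext; intros x Hx; simpl.
rewrite const_on_ball_in by easy; apply plus_zero_r.
Qed.

Lemma Hinf_plus_opp f : Hinf_plus f (Hinf_opp f) = Hinf_const zero.
Proof.
apply Hinf_ext; intros x Hx; simpl.
rewrite const_on_ball_in by easy; exact (@plus_opp_r W (f x)).
Qed.

Definition Hinf_monoid_mixin : AbelianMonoid.mixin_of (Hinf V W) :=
  AbelianMonoid.Mixin _ Hinf_plus (Hinf_const zero)
    Hinf_plus_comm Hinf_plus_assoc Hinf_plus_zero.

End HinfSpace.

Canonical Hinf_AbelianMonoid (V W : NormedModule C_AbsRing) : AbelianMonoid :=
  AbelianMonoid.Pack (Hinf V W) Hinf_monoid_mixin (Hinf V W).

Canonical Hinf_AbelianGroup (V W : NormedModule C_AbsRing) : AbelianGroup :=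
  AbelianGroup.Pack (Hinf V W) (AbelianGroup.Class (Hinf V W) _
    (AbelianGroup.Mixin (Hinf_AbelianMonoid V W) Hinf_opp Hinf_plus_opp))
    (Hinf V W).

Section HinfNormed.
Context {V W : NormedModule C_AbsRing}.
Implicit Types f g : Hinf V W.

Lemma Hinf_scal_assoc (a b : C_Ring) f :
  Hinf_scal a (Hinf_scal b f) = Hinf_scal (mult a b) f.
Proof. apply Hinf_ext; intros x _; exact (@scal_assoc C_AbsRing W a b (f x)). Qed.

Lemma Hinf_scal_one f : Hinf_scal (one : C_Ring) f = f.
Proof. apply Hinf_ext; intros x _; exact (@scal_one C_AbsRing W (f x)). Qed.

Lemma Hinf_scal_plus_l (a : C_Ring) (f g : Hinf_AbelianGroup V W) :
  Hinf_scal a (plus f g) =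
  plus (Hinf_scal a f : Hinf_AbelianGroup V W) (Hinf_scal a g).
Proof. apply Hinf_ext; intros x _; exact (@scal_distr_l C_AbsRing W a (f x) (g x)). Qed.

Lemma Hinf_scal_plus_r (a b : C_Ring) (f : Hinf_AbelianGroup V W) :
  Hinf_scal (plus a b) f =
  plus (Hinf_scal a f : Hinf_AbelianGroup V W) (Hinf_scal b f).
Proof. apply Hinf_ext; intros x _; exact (@scal_distr_r C_AbsRing W a b (f x)). Qed.

(** The supremum is finite: see [Hinf_norm_lub]. *)
Definition Hinf_norm f : R :=
  real (Lub_Rbar (fun r => exists x, open_unit_ball x /\ r = norm (f x))).

Lemma Hinf_norm_lub f :
  is_lub_Rbar (fun r => exists x, open_unit_ball x /\ r = norm (f x))
    (Finite (Hinf_norm f)).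
Proof.
set (E := fun r => exists x, open_unit_ball x /\ r = norm (f x)).
assert (H := Lub_Rbar_correct E).
replace (Finite (Hinf_norm f)) with (Lub_Rbar E); [exact H|].
unfold Hinf_norm; fold E; symmetry; apply is_finite_correct.
destruct (Hinf_bounded f) as [M HM].
assert (H1 : Rbar_le (norm (f zero)) (Lub_Rbar E)).
{ apply (proj1 H); exists zero; split; [apply zero_in_ball | easy]. }
assert (H2 : Rbar_le (Lub_Rbar E) M).
{ apply (proj2 H); intros r [x [Hx ->]]; now apply HM. }
now destruct (Lub_Rbar E) as [r| |]; [exists r | destruct H2 | destruct H1].
Qed.

Lemma Hinf_norm_ge f x : open_unit_ball x -> norm (f x) <= Hinf_norm f.
Proof. intros Hx; apply (proj1 (Hinf_norm_lub f)); now exists x. Qed.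

Lemma Hinf_norm_le f (M : R) :
  (forall x, open_unit_ball x -> norm (f x) <= M) -> Hinf_norm f <= M.
Proof.
intros H; apply (proj2 (Hinf_norm_lub f) (Finite M)).
intros r [x [Hx ->]]; now apply H.
Qed.

Lemma Hinf_norm_triangle f g :
  Hinf_norm (Hinf_plus f g) <= Hinf_norm f + Hinf_norm g.
Proof.
apply Hinf_norm_le; intros x Hx.
eapply Rle_trans; [apply norm_triangle|].
now apply Rplus_le_compat; apply Hinf_norm_ge.
Qed.

Lemma Hinf_norm_scal (k : C) f :
  Hinf_norm (Hinf_scal k f) <= Cmod k * Hinf_norm f.
Proof.
apply Hinf_norm_le; intros x Hx.
eapply Rle_trans; [apply norm_scal|].
now apply Rmult_le_compat_l; [apply Cmod_ge_0 | apply Hinf_norm_ge].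
Qed.

Lemma Hinf_norm_eq_0 f : Hinf_norm f = 0 -> f = Hinf_const zero.
Proof.
intros H; apply Hinf_ext; intros x Hx; simpl.
rewrite const_on_ball_in by easy; apply norm_eq_zero.
apply Rle_antisym; [|apply norm_ge_0].
rewrite <- H; now apply Hinf_norm_ge.
Qed.

End HinfNormed.

Canonical Hinf_ModuleSpace (V W : NormedModule C_AbsRing) : ModuleSpace C_Ring :=
  ModuleSpace.Pack C_Ring (Hinf V W) (ModuleSpace.Class C_Ring (Hinf V W) _
    (ModuleSpace.Mixin C_Ring (Hinf_AbelianGroup V W) Hinf_scal
       Hinf_scal_assoc Hinf_scal_one Hinf_scal_plus_l Hinf_scal_plus_r))
    (Hinf V W).

Definition Hinf_uniform_mixin (V W : NormedModule C_AbsRing) :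
    UniformSpace.mixin_of (Hinf V W) :=
  @norm_uniform_mixin C_AbsRing (Hinf_ModuleSpace V W) Hinf_norm
    Hinf_norm_triangle Hinf_norm_scal.

Canonical Hinf_UniformSpace (V W : NormedModule C_AbsRing) : UniformSpace :=
  UniformSpace.Pack (Hinf V W) (Hinf_uniform_mixin V W) (Hinf V W).

Canonical Hinf_NormedModuleAux (V W : NormedModule C_AbsRing) :
    NormedModuleAux C_AbsRing :=
  NormedModuleAux.Pack C_AbsRing (Hinf V W)
    (NormedModuleAux.Class C_AbsRing (Hinf V W)
      (ModuleSpace.class C_Ring (Hinf_ModuleSpace V W))
      (Hinf_uniform_mixin V W)) (Hinf V W).

Definition Hinf_normed_mixin (V W : NormedModule C_AbsRing) :
    NormedModule.mixin_of C_AbsRing (Hinf_NormedModuleAux V W) :=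
  NormedModule.Mixin C_AbsRing (Hinf_NormedModuleAux V W) Hinf_norm 1
    Hinf_norm_triangle Hinf_norm_scal
    (@norm_ball_refine C_AbsRing (Hinf_ModuleSpace V W) Hinf_norm)
    (@norm_ball_factor C_AbsRing (Hinf_ModuleSpace V W) Hinf_norm)
    Hinf_norm_eq_0.

Canonical Hinf_NormedModule (V W : NormedModule C_AbsRing) :
    NormedModule C_AbsRing :=
  NormedModule.Pack C_AbsRing (Hinf V W)
    (NormedModule.Class C_AbsRing (Hinf V W)
      (NormedModuleAux.class C_AbsRing (Hinf_NormedModuleAux V W))
      (Hinf_normed_mixin V W)) (Hinf V W).

Definition Hinf_scalar : Type := Hinf l2_NormedModule C_NormedModule.
Definition Hinf_l2 : Type := Hinf l2_NormedModule l2_NormedModule.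

(** Extended-real valued, so that [Rbar_le (op_norm P) 1] entails
    boundedness. *)
Definition op_norm {V W : NormedModule C_AbsRing} (P : V -> W) : Rbar :=
  Lub_Rbar (fun r => exists x, norm x <= 1 /\ r = norm (P x)).

Record directed {A : Type} (le : A -> A -> Prop) : Prop := {
  directed_inhabited : inhabited A;
  directed_refl : forall a, le a a;
  directed_trans : forall a b c, le a b -> le b c -> le a c;
  directed_ub : forall a b, exists c, le a c /\ le b c
}.

(** [filterlim u (net_filter le) (locally l)]: the net [u] converges to [l]. *)
Definition net_filter {A : Type} (le : A -> A -> Prop) : (A -> Prop) -> Prop :=
  fun P => exists a0, forall a, le a0 a -> P a.

(** Weak-star convergence, only meant for nets in the unit ball. *)
Definition weak_star_lim {A : Type} (le : A -> A -> Prop)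
    (gg : A -> Hinf_l2) (g : Hinf_l2) : Prop :=
  forall y : l2, open_unit_ball y -> forall v : l2,
    filterlim (fun a => l2_inner (gg a y) v) (net_filter le)
      (locally (l2_inner (g y) v)).

(** The values of [f] outside the open ball are irrelevant: [gg a y] has norm
    less than 1. Only meant for [f] satisfying [Au] and [norm g <= 1]. *)
Definition cluster_set (f : l2 -> C) (g : Hinf_l2) (h : Hinf_scalar) : Prop :=
  exists (A : Type) (le : A -> A -> Prop) (gg : A -> Hinf_l2),
    directed le /\
    (forall a, open_unit_ball (gg a)) /\
    weak_star_lim le gg g /\
    forall y : l2, open_unit_ball y ->
      filterlim (fun a => f (gg a y)) (net_filter le) (locally (h y)).

(** [U] is an open subset of [X]; only the restriction of [F] to [U] matters. *)
Definition contains_analytic_copy {X : NormedModule C_AbsRing}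
    (S : Hinf_scalar -> Prop) (U : X -> Prop) : Prop :=
  exists F : X -> Hinf_scalar,
    (forall u, U u -> S (F u)) /\
    (forall u v, U u -> U v -> F u = F v -> u = v) /\
    (forall x : l2, open_unit_ball x ->
       holomorphic_on (W := C_NormedModule) U (fun u => F u x)).

(* Main.v *)
Require Import Defs.
From Stdlib Require Import Reals Lra Lia.
From Stdlib Require Import Classical ClassicalEpsilon.
From Coquelicot Require Import Coquelicot.

(** Let [x0] be a unit vector of the kernel of [P], [phi y = <y, x0>] and
    [a = |g 0|], so that [a < 1].  Since [g y = g (P y)] and
    [|P y|^2 <= |y|^2 - |phi y|^2], a weak Schwarz lemma
    [|g z - g 0|^2 <= |z| (1 - a)^2] gives
    [|g y| <= 1 - (1 - a) |phi y|^2 / 4].  This leaves room for a function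
    [c = eta phi (1 + eps u)] with [|g|^2 + |c|^2 <= 1] for every [u] in the unit
    ball.  Overwriting the [n]-th coordinate of [g] by [c] and shrinking slightly
    gives a sequence in the open unit ball converging weak-star to [g] along which
    [f0] converges to [f0 o g + c^N].  For small [eps] the map
    [u |-> f0 o g + c^N] is injective, as [t |-> t^N] is injective near 1. *)

Open Scope R_scope.

(** * Trapezoidal sums and Goursat's theorem *)

(** [holomorphic_on] gives a complex derivative at each point, so all analytic estimates are derived
    from Goursat's argument. The estimate required is a Schwarz lemma, whose usual proof divides
    [k z] by [z] and calls for a removable singularity. Dividing the square instead avoids this:
    [k z ^ 2 / z] has derivative [k'(0) ^ 2] at 0 by direct computation. The price is [|z|] in place
    of [|z| ^ 2], hence 1/4 where Schwarz's lemma would give 1/2; any positive factor would do.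
    Hypothesis (1) bounds [g - g 0] by [1 - a], so a gain in the Schwarz factor is a gain in [|g y|]
    itself. The factor [phi] in [c] makes [|c|^2] vanish as fast as this gain. The summand 1 in
    [1 + eps u] keeps the base of the power away from 0, where roots of unity would identify
    different [u]. The overwritten coordinate escapes weakly, since the coordinates of a fixed
    vector of l2 tend to 0, whereas [f0] weighs all coordinates alike and retains [c^N]. *)

Lemma ex_filterdiff_eps {V W : NormedModule C_AbsRing} (f : V -> W) (x : V) :
  ex_filterdiff f (locally x) <->
  exists l : V -> W, is_linear l /\ forall eps : R, 0 < eps ->
    exists d : R, 0 < d /\ forall y, norm (minus y x) < d ->
      norm (minus (minus (f y) (f x)) (l (minus y x))) <= eps * norm (minus y x).
Proof.
split.
- intros [l [Hl H]]; exists l; split; [exact Hl|]; intros eps He.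
  assert (H1 := H x (fun P HP => HP) (mkposreal eps He)).
  apply locally_norm_le_locally in H1; destruct H1 as [d Hd].
  exists d; split; [apply cond_pos|]; intros y Hy; apply (Hd y Hy).
- intros [l [Hl H]]; exists l; split; [exact Hl|].
  intros x' Hx' eps.
  rewrite <- (is_filter_lim_locally_unique _ _ Hx').
  destruct (H eps (cond_pos eps)) as [d [Hd H1]].
  apply locally_le_locally_norm; exists (mkposreal d Hd).
  intros y Hy; apply H1, Hy.
Qed.

Definition C_diff (F : C -> C) (p : C) : Prop :=
  ex_filterdiff (U := C_NormedModule) (V := C_NormedModule) F (locally p).

Lemma C_is_linear_mult (l : C) :
  is_linear (U := C_NormedModule) (V := C_NormedModule) (fun z : C => (l * z)%C).
Proof.
split.
- intros x y; apply (Cmult_plus_distr_l l x y).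
- intros k x; change ((l * (k * x))%C = (k * (l * x))%C); ring.
- exists (Cmod l + 1); split; [assert (H := Cmod_ge_0 l); lra|].
  intros x; change (Cmod (l * x) <= (Cmod l + 1) * Cmod x).
  rewrite Cmod_mult; assert (H := Cmod_ge_0 x); nra.
Qed.

Lemma C_diff_eps (F : C -> C) (p : C) :
  C_diff F p <->
  exists l : C, forall eps : R, 0 < eps -> exists d : R, 0 < d /\
    forall z, Cmod (z - p) < d ->
      Cmod (F z - F p - l * (z - p)) <= eps * Cmod (z - p).
Proof.
unfold C_diff; rewrite ex_filterdiff_eps; split.
- intros [l [Hl H]]; exists (l (RtoC 1)); intros eps He.
  destruct (H eps He) as [d [Hd H1]]; exists d; split; [exact Hd|].
  intros z Hz; specialize (H1 z Hz).
  replace (l (RtoC 1) * (z - p))%C with (l (minus z p)); [exact H1|].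
  transitivity (l (scal (minus z p : C_AbsRing) (RtoC 1 : C_NormedModule))).
  + f_equal; change ((z - p)%C = ((z - p) * 1)%C); ring.
  + rewrite (linear_scal l Hl (minus z p : C_AbsRing)).
    change (((z - p) * l (RtoC 1))%C = (l (RtoC 1) * (z - p))%C); ring.
- intros [l H]; exists (fun z : C => (l * z)%C); split; [apply C_is_linear_mult|].
  exact H.
Qed.

(* Refined trapezoidal sums on the segment from [p] to [q] replace contour
   integrals: they are additive under bisection by definition and exact on
   affine functions, so Goursat's argument needs no integration theory. *)
Fixpoint trap (F : C -> C) (n : nat) (p q : C) : C :=
  match n with
  | O => ((q - p) * ((F p + F q) / 2))%C
  | S m => (trap F m p ((p + q) / 2) + trap F m ((p + q) / 2) q)%C
  end.

(** Stands in for convexity: [trap] evaluates its function at iterated midpoints of the end points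
    and nowhere else. It is applied to discs and to vertical lines. *)
Definition midpoint_closed (S : C -> Prop) : Prop :=
  forall u v, S u -> S v -> S ((u + v) / 2)%C.

Lemma Cmod_half (z : C) : Cmod (z / 2) = Cmod z / 2.
Proof.
rewrite Cmod_div, Cmod_R, Rabs_pos_eq; [reflexivity|lra|].
intros H; apply RtoC_inj in H; lra.
Qed.

Lemma C2_neq_0 : RtoC 2 <> 0%C.
Proof. intros H; apply RtoC_inj in H; lra. Qed.

Ltac Cfield := field; repeat split; exact C2_neq_0.

Lemma trap_sym (F : C -> C) n p q : trap F n q p = (- trap F n p q)%C.
Proof.
revert p q; induction n as [|n IH]; intros p q; simpl.
- Cfield.
- rewrite (Cplus_comm q p), (IH ((p + q) / 2)%C p), (IH q ((p + q) / 2)%C).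
  rewrite (IH ((p + q) / 2)%C q); ring.
Qed.

Lemma trap_minus (F G : C -> C) n p q :
  trap (fun z => F z - G z)%C n p q = (trap F n p q - trap G n p q)%C.
Proof.
revert p q; induction n as [|n IH]; intros p q; simpl.
- Cfield.
- rewrite !IH; ring.
Qed.

Lemma trap_affine (a b : C) n p q :
  trap (fun z => a + b * z)%C n p q
  = ((a * q + b * q * q / 2) - (a * p + b * p * p / 2))%C.
Proof.
revert p q; induction n as [|n IH]; intros p q; simpl.
- Cfield.
- rewrite !IH; Cfield.
Qed.

Lemma trap_const (a : C) n p q : trap (fun _ => a) n p q = (a * (q - p))%C.
Proof.
revert p q; induction n as [|n IH]; intros p q; simpl.
- Cfield.
- rewrite !IH; Cfield.
Qed.

(** The length-times-supremum estimate of contour integrals, uniform in the refinement level because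
    the two half segments have half the length each. *)
Lemma trap_bound (S : C -> Prop) (F : C -> C) (K : R) n p q :
  midpoint_closed S -> (forall z, S z -> Cmod (F z) <= K) -> S p -> S q ->
  Cmod (trap F n p q) <= Cmod (q - p) * K.
Proof.
intros HS HK; revert p q; induction n as [|n IH]; intros p q Hp Hq; simpl.
- rewrite Cmod_mult, Cmod_half.
  apply Rmult_le_compat_l; [apply Cmod_ge_0|].
  assert (H := Cmod_triangle (F p) (F q)).
  assert (H1 := HK p Hp); assert (H2 := HK q Hq); lra.
- assert (H := HS p q Hp Hq).
  eapply Rle_trans; [apply Cmod_triangle|].
  assert (H1 := IH _ _ Hp H); assert (H2 := IH _ _ H Hq).
  replace ((p + q) / 2 - p)%C with ((q - p) / 2)%C in H1 by Cfield.
  replace (q - (p + q) / 2)%C with ((q - p) / 2)%C in H2 by Cfield.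
  rewrite Cmod_half in H1, H2; lra.
Qed.

(** The contour sum around the parallelogram with corner [p] and edge vectors [a], [b]. *)
Definition rect (F : C -> C) (n : nat) (p a b : C) : C :=
  (trap F n p (p + a) + trap F n (p + a) (p + a + b)
   + trap F n (p + a + b) (p + b) + trap F n (p + b) p)%C.

(** Each inner edge is traversed twice in opposite directions and cancels. The identity is exact, at
    the cost of lowering the refinement level by one. *)
Lemma rect_S (F : C -> C) n p a b :
  rect F (S n) p a b =
  (rect F n p (a / 2) (b / 2) + rect F n (p + a / 2) (a / 2) (b / 2)
   + rect F n (p + b / 2) (a / 2) (b / 2)
   + rect F n (p + a / 2 + b / 2) (a / 2) (b / 2))%C.
Proof.
unfold rect; simpl.
replace ((p + (p + a)) / 2)%C with (p + a / 2)%C by Cfield.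
replace ((p + a + (p + a + b)) / 2)%C with (p + a + b / 2)%C by Cfield.
replace ((p + a + b + (p + b)) / 2)%C with (p + a / 2 + b)%C by Cfield.
replace ((p + b + p) / 2)%C with (p + b / 2)%C by Cfield.
replace (p + a / 2 + a / 2)%C with (p + a)%C by Cfield.
replace (p + b / 2 + a / 2)%C with (p + a / 2 + b / 2)%C by ring.
replace (p + b / 2 + b / 2)%C with (p + b)%C by Cfield.
replace (p + a / 2 + b / 2 + a / 2)%C with (p + a + b / 2)%C by Cfield.
replace (p + a + b / 2 + b / 2)%C with (p + a + b)%C by Cfield.
replace (p + a / 2 + b / 2 + b / 2)%C with (p + a / 2 + b)%C by Cfield.
rewrite (trap_sym F n (p + a / 2) (p + a / 2 + b / 2)).
rewrite (trap_sym F n (p + b / 2) (p + a / 2 + b / 2)).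
rewrite (trap_sym F n (p + a / 2 + b / 2) (p + a + b / 2)).
rewrite (trap_sym F n (p + a / 2 + b / 2) (p + a / 2 + b)).
ring.
Qed.

(* Negates [rect F n p a b -> 0] quantitatively, in a form inherited by one of
   the four halved parallelograms. *)
Definition rect_bad (F : C -> C) (p a b : C) (c : R) : Prop :=
  forall n0, exists n, (n0 <= n)%nat /\ c < Cmod (rect F n p a b).

Lemma not_rect_bad F p a b c : ~ rect_bad F p a b c ->
  exists n0, forall n, (n0 <= n)%nat -> Cmod (rect F n p a b) <= c.
Proof.
intros H; apply not_all_ex_not in H; destruct H as [n0 H].
exists n0; intros n Hn; apply Rnot_lt_le; intros H1; apply H; now exists n.
Qed.

Lemma rect_bad_split F p a b c : rect_bad F p a b c ->
  rect_bad F p (a / 2) (b / 2) (c / 4) \/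
  rect_bad F (p + a / 2) (a / 2) (b / 2) (c / 4) \/
  rect_bad F (p + b / 2) (a / 2) (b / 2) (c / 4) \/
  rect_bad F (p + a / 2 + b / 2) (a / 2) (b / 2) (c / 4).
Proof.
intros H; apply NNPP; intros H'.
apply not_or_and in H'; destruct H' as [H1 H'].
apply not_or_and in H'; destruct H' as [H2 H'].
apply not_or_and in H'; destruct H' as [H3 H4].
apply not_rect_bad in H1, H2, H3, H4.
destruct H1 as [n1 H1], H2 as [n2 H2], H3 as [n3 H3], H4 as [n4 H4].
(* The sum exceeds all four thresholds; the successor pays for the level lost in [rect_S]. *)
destruct (H (S (n1 + n2 + n3 + n4))) as [n [Hn Hc]].
destruct n as [|n]; [lia|].
rewrite rect_S in Hc.
specialize (H1 n ltac:(lia)); specialize (H2 n ltac:(lia));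
specialize (H3 n ltac:(lia)); specialize (H4 n ltac:(lia)).
match type of Hc with _ < Cmod (?x + ?y + ?z + ?t) =>
  assert (E1 := Cmod_triangle (x + y + z) t);
  assert (E2 := Cmod_triangle (x + y) z);
  assert (E3 := Cmod_triangle x y) end.
lra.
Qed.

Definition par_point (p a b : C) (x y : R) : C := (p + x * a + y * b)%C.

(** Each corner coordinate moves by 0 or [(/ 2) ^ S m]. The bound is written as
    [(/ 2) ^ m - (/ 2) ^ S m] so that it telescopes in [nested_halving_limit]. *)
Lemma rect_bad_step F p a b c m x y :
  rect_bad F (par_point p a b x y) (RtoC ((/ 2) ^ m) * a) (RtoC ((/ 2) ^ m) * b)
    (c * (/ 4) ^ m) ->
  exists xy : R * R,
    x <= fst xy <= x + (/ 2) ^ m - (/ 2) ^ S m /\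
    y <= snd xy <= y + (/ 2) ^ m - (/ 2) ^ S m /\
    rect_bad F (par_point p a b (fst xy) (snd xy))
      (RtoC ((/ 2) ^ S m) * a) (RtoC ((/ 2) ^ S m) * b) (c * (/ 4) ^ S m).
Proof.
intros H; apply rect_bad_split in H.
assert (Hm : 0 < (/ 2) ^ m) by (apply pow_lt; lra).
assert (E : forall z, (RtoC ((/ 2) ^ m) * z / 2 = RtoC ((/ 2) ^ S m) * z)%C).
{ intros z; rewrite <- tech_pow_Rmult, RtoC_mult, RtoC_inv by lra; Cfield. }
assert (E4 : c * (/ 4) ^ m / 4 = c * (/ 4) ^ S m) by (simpl; field).
rewrite !E, E4 in H.
assert (Q : forall u v, (u = 0 \/ u = 1) -> (v = 0 \/ v = 1) ->
  par_point p a b (x + u * (/ 2) ^ S m) (y + v * (/ 2) ^ S m) =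
  (par_point p a b x y + u * (RtoC ((/ 2) ^ S m) * a)
    + v * (RtoC ((/ 2) ^ S m) * b))%C).
{ intros u v _ _; unfold par_point; rewrite !RtoC_plus, !RtoC_mult; ring. }
assert (D : forall u v, (u = 0 \/ u = 1) -> (v = 0 \/ v = 1) ->
  rect_bad F (par_point p a b (x + u * (/ 2) ^ S m) (y + v * (/ 2) ^ S m))
    (RtoC ((/ 2) ^ S m) * a) (RtoC ((/ 2) ^ S m) * b) (c * (/ 4) ^ S m) ->
  exists xy : R * R,
    x <= fst xy <= x + (/ 2) ^ m - (/ 2) ^ S m /\
    y <= snd xy <= y + (/ 2) ^ m - (/ 2) ^ S m /\
    rect_bad F (par_point p a b (fst xy) (snd xy))
      (RtoC ((/ 2) ^ S m) * a) (RtoC ((/ 2) ^ S m) * b) (c * (/ 4) ^ S m)).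
{ intros u v Hu Hv HB.
  exists (x + u * (/ 2) ^ S m, y + v * (/ 2) ^ S m); simpl fst; simpl snd.
  split; [|split; [|exact HB]]; simpl; destruct Hu, Hv; subst; lra. }
destruct H as [H|[H|[H|H]]];
  [apply (D 0 0) | apply (D 1 0) | apply (D 0 1) | apply (D 1 1)]; auto;
  rewrite Q by auto;
  rewrite ?Cmult_0_l, ?Cmult_1_l, ?Cplus_0_r; exact H.
Qed.

(** The right end points [x m + (/ 2) ^ m] do not increase, so the intervals are nested and the
    limit of the left end points lies in all of them. *)
Lemma nested_halving_limit (x : nat -> R) : x O = 0 ->
  (forall m, x m <= x (S m) <= x m + (/ 2) ^ m - (/ 2) ^ S m) ->
  exists l : R, forall m, x m <= l <= x m + (/ 2) ^ m.
Proof.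
intros H0 H.
assert (Hm : forall m, 0 < (/ 2) ^ m) by (intros m; apply pow_lt; lra).
assert (H1 : forall m k, x m <= x (m + k)%nat <= x m + (/ 2) ^ m - (/ 2) ^ (m + k)).
{ intros m; induction k as [|k IH].
  - rewrite Nat.add_0_r; lra.
  - rewrite Nat.add_succ_r; specialize (H (m + k)%nat); lra. }
destruct (ex_finite_lim_seq_incr x 1) as [l Hl].
- intros m; apply H.
- intros m; specialize (H1 O m); simpl in H1; specialize (Hm m); lra.
- exists l; intros m; split.
  + apply is_lim_seq_incr_compare with (1 := Hl); intros n; apply H.
  + assert (Hl' := proj1 (is_lim_seq_incr_n x m l) Hl).
    refine (is_lim_seq_le _ _ (Finite l) (Finite (x m + (/ 2) ^ m))
      _ Hl' (is_lim_seq_const _)).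
    intros n; simpl; rewrite Nat.add_comm.
    specialize (H1 m n); specialize (Hm (m + n)%nat); lra.
Qed.

(** Sums of an affine function are differences of a primitive and telescope to 0 around the closed
    contour. What remains is the approximation error times the perimeter. *)
Lemma rect_affine_approx F n p a b z al be r : 0 <= r ->
  Cmod (p - z) <= r -> Cmod (p + a - z) <= r ->
  Cmod (p + a + b - z) <= r -> Cmod (p + b - z) <= r ->
  forall eps, (forall w, Cmod (w - z) <= r -> Cmod (F w - (al + be * w)) <= eps) ->
  Cmod (rect F n p a b) <= 2 * (Cmod a + Cmod b) * eps.
Proof.
intros Hr H1 H2 H3 H4 eps He.
set (G := fun w => (F w - (al + be * w))%C).
assert (E : rect F n p a b = rect G n p a b).
{ unfold rect, G; rewrite !(trap_minus F (fun w => al + be * w)%C), !trap_affine.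
  ring. }
rewrite E; unfold rect.
assert (HS : midpoint_closed (fun w => Cmod (w - z) <= r)).
{ intros u v Hu Hv.
  replace ((u + v) / 2 - z)%C with (((u - z) + (v - z)) / 2)%C by Cfield.
  rewrite Cmod_half; assert (T := Cmod_triangle (u - z) (v - z)); lra. }
assert (B := fun u v => trap_bound _ G eps n u v HS He).
assert (B1 := B _ _ H1 H2); assert (B2 := B _ _ H2 H3);
assert (B3 := B _ _ H3 H4); assert (B4 := B _ _ H4 H1).
replace (p + a - p)%C with a in B1 by ring.
replace (p + a + b - (p + a))%C with b in B2 by ring.
replace (p + b - (p + a + b))%C with (- a)%C in B3 by ring.
replace (p - (p + b))%C with (- b)%C in B4 by ring.
rewrite Cmod_opp in B3, B4.
match goal with |- Cmod (?x + ?y + ?z + ?t) <= _ =>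
  assert (E1 := Cmod_triangle (x + y + z) t);
  assert (E2 := Cmod_triangle (x + y) z);
  assert (E3 := Cmod_triangle x y) end.
lra.
Qed.

Lemma goursat F p a b :
  (forall x y, 0 <= x <= 1 -> 0 <= y <= 1 -> C_diff F (par_point p a b x y)) ->
  forall c, 0 < c -> exists n0, forall n, (n0 <= n)%nat ->
    Cmod (rect F n p a b) <= c.
Proof.
intros HF c Hc; apply not_rect_bad; intros H0.
set (Q := fun m (xy : R * R) =>
  rect_bad F (par_point p a b (fst xy) (snd xy))
    (RtoC ((/ 2) ^ m) * a) (RtoC ((/ 2) ^ m) * b) (c * (/ 4) ^ m)).
assert (Q0 : Q O (0, 0)).
{ unfold Q, par_point; simpl.
  replace (p + 0 * a + 0 * b)%C with p by ring.
  rewrite !Cmult_1_l, Rmult_1_r; exact H0. }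
(* The invariant [Q] travels with the corner in a sigma type, since choosing the next corner
   requires the proof that the current one is bad. *)
set (step := fun m (s : {xy | Q m xy}) =>
  constructive_indefinite_description _
    (rect_bad_step F p a b c m (fst (proj1_sig s)) (snd (proj1_sig s)) (proj2_sig s))).
set (sq := fix sq m : {xy | Q m xy} :=
  match m with
  | O => exist _ (0, 0) Q0
  | S k => let t := step k (sq k) in
           exist _ (proj1_sig t) (proj2 (proj2 (proj2_sig t)))
  end).
destruct (nested_halving_limit (fun m => fst (proj1_sig (sq m)))) as [x Hx].
{ reflexivity. }
{ intros m; exact (proj1 (proj2_sig (step m (sq m)))). }
destruct (nested_halving_limit (fun m => snd (proj1_sig (sq m)))) as [y Hy].
{ reflexivity. }
{ intros m; exact (proj1 (proj2 (proj2_sig (step m (sq m))))). }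
destruct (proj1 (C_diff_eps _ _) (HF x y ltac:(specialize (Hx O); simpl in Hx; lra)
  ltac:(specialize (Hy O); simpl in Hy; lra))) as [l Hl].
set (z := par_point p a b x y) in *.
(* At scale [h], [h * L] bounds both half the perimeter and the distance from [z] to the vertices;
   the 1 keeps [L] positive for degenerate edges. *)
set (L := Cmod a + Cmod b + 1).
assert (HL : 0 < L).
{ unfold L; assert (A := Cmod_ge_0 a); assert (B := Cmod_ge_0 b); lra. }
assert (HL2 : 0 < L * L) by now apply Rmult_lt_0_compat.
(* Chosen so that perimeter [2 h L] times error [c / (2 L^2) * h L] equals [c h^2], which is the
   badness threshold [c * (/ 4) ^ m]. *)
destruct (Hl (c / (2 * (L * L)))) as [d [Hd Hd']].
{ apply Rdiv_lt_0_compat; lra. }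
destruct (pow_lt_1_zero (/ 2) ltac:(rewrite Rabs_pos_eq; lra) (d / L)) as [m Hm].
{ now apply Rdiv_lt_0_compat. }
specialize (Hm m (le_n m)).
assert (Hm0 : 0 < (/ 2) ^ m) by (apply pow_lt; lra).
rewrite Rabs_pos_eq in Hm by lra.
specialize (Hx m); specialize (Hy m); simpl in Hx, Hy.
destruct (proj2_sig (sq m) O) as [n [_ Hn]].
set (xm := fst (proj1_sig (sq m))) in *.
set (ym := snd (proj1_sig (sq m))) in *.
set (h := (/ 2) ^ m) in *.
assert (Hr : h * L < d).
{ apply (Rmult_lt_compat_r L) in Hm; [|exact HL].
  unfold Rdiv in Hm; rewrite Rmult_assoc, Rinv_l in Hm; lra. }
assert (K : forall u v, 0 <= u <= 1 -> 0 <= v <= 1 ->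
  Cmod (par_point p a b xm ym + u * (h * a) + v * (h * b) - z) <= h * L).
{ intros u v Hu Hv; unfold z, par_point.
  replace (_ - _)%C with (RtoC (xm + u * h - x) * a + RtoC (ym + v * h - y) * b)%C
    by (rewrite !RtoC_minus, !RtoC_plus, !RtoC_mult; ring).
  eapply Rle_trans; [apply Cmod_triangle|].
  rewrite !Cmod_mult, !Cmod_R.
  assert (A1 : Rabs (xm + u * h - x) <= h) by (apply Rabs_le; nra).
  assert (A2 : Rabs (ym + v * h - y) <= h) by (apply Rabs_le; nra).
  assert (A := Cmod_ge_0 a); assert (B := Cmod_ge_0 b); unfold L; nra. }
set (P := par_point p a b xm ym) in *.
assert (K0 := K 0 0 ltac:(lra) ltac:(lra)); assert (K1 := K 1 0 ltac:(lra) ltac:(lra)).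
assert (K2 := K 1 1 ltac:(lra) ltac:(lra)); assert (K3 := K 0 1 ltac:(lra) ltac:(lra)).
rewrite !Cmult_0_l, !Cplus_0_r in K0.
rewrite Cmult_0_l, Cmult_1_l, Cplus_0_r in K1.
rewrite !Cmult_1_l in K2.
rewrite Cmult_0_l, Cmult_1_l, Cplus_0_r in K3.
assert (Hw : forall w, Cmod (w - z) <= h * L ->
  Cmod (F w - (F z - l * z + l * w)) <= c / (2 * (L * L)) * (h * L)).
{ intros w Hw.
  replace (F w - (F z - l * z + l * w))%C with (F w - F z - l * (w - z))%C by ring.
  eapply Rle_trans; [apply Hd'; lra|].
  apply Rmult_le_compat_l; [left; apply Rdiv_lt_0_compat; lra | exact Hw]. }
assert (Hfin := rect_affine_approx F n P (h * a) (h * b) z (F z - l * z) l (h * L)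
  ltac:(nra) K0 K1 K2 K3 _ Hw).
assert (E4 : (/ 4) ^ m = h * h).
{ unfold h; rewrite <- Rpow_mult_distr; f_equal; field. }
rewrite E4 in Hn.
assert (Hab : Cmod (h * a) + Cmod (h * b) <= h * L).
{ rewrite !Cmod_mult, Cmod_R, Rabs_pos_eq by lra; unfold L; nra. }
assert (Hbound : 2 * (h * L) * (c / (2 * (L * L)) * (h * L)) = c * (h * h)).
{ field; lra. }
assert (Hpos : 0 <= c / (2 * (L * L)) * (h * L)).
{ apply Rmult_le_pos; [left; apply Rdiv_lt_0_compat; lra | nra]. }
apply (Rmult_le_compat_r _ _ _ Hpos) in Hab.
change (c * (h * h) < Cmod (rect F n P (h * a) (h * b))) in Hn.
lra.
Qed.

(** * Complex differentiable functions on the disc *)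

(** Makes the two sides of a rectangle that differ by a period cancel. *)
Lemma trap_shift (F : C -> C) (b : C) n p q : (forall w, F (w + b)%C = F w) ->
  trap F n (p + b) (q + b) = trap F n p q.
Proof.
intros HF; revert p q; induction n as [|n IH]; intros p q; simpl.
- rewrite !HF; Cfield.
- replace ((p + b + (q + b)) / 2)%C with ((p + q) / 2 + b)%C by Cfield.
  now rewrite !IH.
Qed.

Lemma Cmod_le_Rabs (z : C) : Cmod z <= Rabs (Re z) + Rabs (Im z).
Proof.
assert (H := Cmod2_alt z); assert (H0 := Cmod_ge_0 z).
assert (A := Rabs_pos (Re z)); assert (B := Rabs_pos (Im z)).
apply Rsqr_incr_0_var; [|lra]; rewrite !Rsqr_pow2, H.
rewrite <- (pow2_abs (Re z)), <- (pow2_abs (Im z)); nra.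
Qed.

(** * The complex exponential *)

Definition Cexp (w : C) : C := (exp (Re w) * cos (Im w), exp (Re w) * sin (Im w)).

Lemma Cexp_plus (u v : C) : Cexp (u + v) = (Cexp u * Cexp v)%C.
Proof.
destruct u as [a b], v as [c d]; unfold Cexp, Cplus, Cmult; simpl.
rewrite exp_plus, cos_plus, sin_plus; f_equal; ring.
Qed.

Lemma Cmod_Cexp (w : C) : Cmod (Cexp w) = exp (Re w).
Proof.
assert (H := sin2_cos2 (Im w)); rewrite !Rsqr_pow2 in H.
apply Rsqr_inj; [apply Cmod_ge_0 | left; apply exp_pos |].
rewrite !Rsqr_pow2, Cmod2_alt; unfold Cexp; simpl Re; simpl Im.
replace (exp (Re w) ^ 2) with (exp (Re w) ^ 2 * 1) by ring; rewrite <- H; ring.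
Qed.

Lemma derivable_pt_lim_0 (f : R -> R) (l eps : R) : derivable_pt_lim f 0 l ->
  0 < eps -> exists d, 0 < d /\ forall h, Rabs h < d ->
    Rabs (f h - f 0 - l * h) <= eps * Rabs h.
Proof.
intros H He; destruct (H eps He) as [d Hd].
exists d; split; [apply cond_pos|]; intros h Hh.
destruct (Req_dec h 0) as [->|Hn].
- replace (f 0 - f 0 - l * 0) with 0 by ring; rewrite Rabs_R0; lra.
- specialize (Hd h Hn Hh); rewrite Rplus_0_l in Hd.
  replace (f h - f 0 - l * h) with (((f h - f 0) / h - l) * h) by (field; easy).
  rewrite Rabs_mult; apply Rmult_le_compat_r; [apply Rabs_pos | lra].
Qed.

(** The functional equation moves the question to 0, where the real derivatives of [exp], [cos] and
    [sin] give the remainder. *)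
Lemma C_diff_Cexp (p : C) : C_diff Cexp p.
Proof.
apply C_diff_eps; exists (Cexp p); intros eps0 He0.
(* In units of [eps * r], the remainder is at most 4 in the real part and 5 in the imaginary
   part. *)
set (K := 9 * (Cmod (Cexp p) + 1)).
assert (HK : 0 < K) by (unfold K; assert (H := Cmod_ge_0 (Cexp p)); lra).
set (eps := Rmin 1 (eps0 / K)).
assert (He : 0 < eps) by (apply Rmin_pos; [lra | now apply Rdiv_lt_0_compat]).
assert (He1 : eps <= 1) by apply Rmin_l.
assert (HeK : K * eps <= eps0).
{ apply Rle_trans with (K * (eps0 / K)); [|right; field; lra].
  apply Rmult_le_compat_l; [lra | apply Rmin_r]. }
destruct (derivable_pt_lim_0 exp 1 eps) as [d1 [Hd1 D1]]; [|exact He|].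
{ rewrite <- exp_0; apply derivable_pt_lim_exp. }
destruct (derivable_pt_lim_0 cos 0 eps) as [d2 [Hd2 D2]]; [|exact He|].
{ replace 0 with (- sin 0) at 2 by (rewrite sin_0; ring).
  apply derivable_pt_lim_cos. }
destruct (derivable_pt_lim_0 sin 1 eps) as [d3 [Hd3 D3]]; [|exact He|].
{ rewrite <- cos_0; apply derivable_pt_lim_sin. }
(* Including [eps] in the radius turns the quadratic term [y * (x + e1)] into one of order
   [eps * r]. *)
exists (Rmin (Rmin d1 d2) (Rmin d3 eps)); split; [apply Rmin_pos; apply Rmin_pos; assumption|].
intros z Hz.
assert (Hz' := Hz); apply Rmin_Rgt_l in Hz'; destruct Hz' as [Ha Hb].
apply Rmin_Rgt_l in Ha, Hb.
set (w := (z - p)%C) in *.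
assert (E : (Cexp z - Cexp p - Cexp p * w = Cexp p * (Cexp w - 1 - w))%C).
{ replace z with (p + w)%C by (unfold w; ring); rewrite Cexp_plus; ring. }
rewrite E, Cmod_mult.
assert (Rw := re_le_Cmod w).
assert (Iw : Rabs (Im w) <= Cmod w).
{ eapply Rle_trans; [|apply Rmax_Cmod]; apply Rmax_r. }
assert (Hw : Cmod (Cexp w - 1 - w) <= 9 * eps * Cmod w).
{ eapply Rle_trans; [apply Cmod_le_Rabs|].
  unfold Cexp; destruct w as [x y]; simpl in *.
  specialize (D1 x ltac:(lra)); specialize (D2 y ltac:(lra));
  specialize (D3 y ltac:(lra)).
  rewrite exp_0 in D1; rewrite cos_0 in D2; rewrite sin_0 in D3.
  set (e1 := exp x - 1 - 1 * x) in *.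
  set (e2 := cos y - 1 - 0 * y) in *.
  set (e3 := sin y - 0 - 1 * y) in *.
  replace (exp x * cos y + - (1) + - x) with (e1 + e2 * (1 + x + e1))
    by (unfold e1, e2; ring).
  replace (exp x * sin y + - 0 + - y) with (e3 * (1 + x + e1) + y * (x + e1))
    by (unfold e1, e3; ring).
  set (r := Cmod (x, y)) in *.
  assert (X := Rabs_pos x); assert (Y := Rabs_pos y).
  assert (A1 : Rabs e1 <= eps * r) by nra.
  assert (A2 : Rabs e2 <= eps * r) by nra.
  assert (A3 : Rabs e3 <= eps * r) by nra.
  assert (r1 : r <= 1) by lra.
  assert (r0 : 0 <= r) by lra.
  assert (B1 : Rabs (x + e1) <= 2 * r).
  { eapply Rle_trans; [apply Rabs_triang|]; nra. }
  assert (B2 : Rabs (1 + x + e1) <= 3).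
  { rewrite Rplus_assoc; eapply Rle_trans; [apply Rabs_triang|].
    rewrite Rabs_R1; lra. }
  assert (T1 := Rabs_triang e1 (e2 * (1 + x + e1))).
  assert (T2 := Rabs_triang (e3 * (1 + x + e1)) (y * (x + e1))).
  rewrite Rabs_mult in T1; rewrite !Rabs_mult in T2.
  assert (P2 := Rabs_pos e2); assert (P3 := Rabs_pos e3).
  assert (M1 : Rabs e2 * Rabs (1 + x + e1) <= eps * r * 3)
    by (apply Rmult_le_compat; try apply Rabs_pos; lra).
  assert (M2 : Rabs e3 * Rabs (1 + x + e1) <= eps * r * 3)
    by (apply Rmult_le_compat; try apply Rabs_pos; lra).
  assert (M3 : Rabs y * Rabs (x + e1) <= eps * (2 * r))
    by (apply Rmult_le_compat; try apply Rabs_pos; lra).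
  lra. }
assert (P0 := Cmod_ge_0 (Cexp p)); assert (W0 := Cmod_ge_0 w).
apply Rle_trans with (K * eps * Cmod w); [|now apply Rmult_le_compat_r].
apply Rle_trans with (Cmod (Cexp p) * (9 * eps * Cmod w)).
- now apply Rmult_le_compat_l.
- unfold K; assert (0 <= eps * Cmod w) by (apply Rmult_le_pos; lra); nra.
Qed.

Lemma C_diff_cont (F : C -> C) p : C_diff F p -> forall eps, 0 < eps ->
  exists d, 0 < d /\ forall z, Cmod (z - p) < d -> Cmod (F z - F p) <= eps.
Proof.
intros H eps He; apply C_diff_eps in H; destruct H as [l Hl].
destruct (Hl 1 Rlt_0_1) as [d [Hd H]].
assert (L := Cmod_ge_0 l).
exists (Rmin d (eps / (Cmod l + 1))); split.
{ apply Rmin_pos; [easy|]; apply Rdiv_lt_0_compat; lra. }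
intros z Hz; apply Rmin_Rgt_l in Hz; destruct Hz as [Hz1 Hz2].
specialize (H z Hz1).
replace (F z - F p)%C with ((F z - F p - l * (z - p)) + l * (z - p))%C by ring.
eapply Rle_trans; [apply Cmod_triangle|]; rewrite Cmod_mult.
assert (Hz3 : Cmod (z - p) * (Cmod l + 1) < eps).
{ apply (Rmult_lt_compat_r (Cmod l + 1)) in Hz2; [|lra].
  unfold Rdiv in Hz2; rewrite Rmult_assoc, Rinv_l in Hz2; lra. }
lra.
Qed.

(** * The mean value inequality on circles *)

Lemma Cexp_period (w : C) : Cexp (w + (0, 2 * PI)) = Cexp w.
Proof.
rewrite Cexp_plus; unfold Cexp at 2; simpl.
rewrite cos_2PI, sin_2PI, exp_0.
destruct (Cexp w) as [x y]; unfold Cmult; simpl; f_equal; ring.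
Qed.

Lemma midpoint_closed_Re (s : R) : midpoint_closed (fun w => Re w = s).
Proof.
intros [a b] [c d]; simpl; intros -> ->.
unfold Re, Cdiv, Cmult, Cinv; simpl; field.
Qed.

(** In the coordinate [w] with [z = Cexp w], an annulus becomes a rectangle of height [2 * PI], and
    [dz / z] becomes [dw]. Goursat's theorem and periodicity show that the sums over the outer and
    the inner circle nearly agree; the inner one is close to [f 0] times the period. *)
Lemma mean_value_inequality (f : C -> C) (rho M : R) :
  (forall z, Cmod z < 1 -> C_diff f z) -> 0 < rho < 1 ->
  (forall z, Cmod z = rho -> Cmod (f z) <= M) -> Cmod (f 0%C) <= M.
Proof.
intros Hf Hrho HM.
assert (Hpi := PI_RGT_0).
set (F := fun w => f (Cexp w)).
set (b := (0, 2 * PI) : C).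
assert (Hb : Cmod b = 2 * PI).
{ replace b with (Ci * RtoC (2 * PI))%C
    by (unfold b, Ci, Cmult; simpl; f_equal; ring).
  rewrite Cmod_mult, Cmod_Ci, Cmod_R, Rabs_pos_eq; lra. }
assert (HF : forall w, F (w + b)%C = F w)
  by (intros w; unfold F, b; now rewrite Cexp_period).
apply le_epsilon; intros eps He.
destruct (C_diff_cont f 0%C (Hf 0%C ltac:(rewrite Cmod_0; lra)) (eps / 2) ltac:(lra))
  as [d [Hd Hd']].
set (s2 := ln rho).
assert (E2 : exp s2 = rho) by (apply exp_ln; lra).
(* The inner circle is so small that [f] stays within [eps / 2] of [f 0] on it; the minimum with
   [rho] keeps it inside the outer circle. *)
set (s1 := ln (Rmin rho (d / 2))).
assert (E1 : exp s1 = Rmin rho (d / 2)).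
{ apply exp_ln, Rmin_pos; lra. }
assert (H12 : s1 <= s2).
{ apply Rnot_lt_le; intros H; apply exp_increasing in H.
  rewrite E1, E2 in H; assert (H1 := Rmin_l rho (d / 2)); lra. }
(* The tolerance [PI * eps] and the inner error [2 * PI * (eps / 2)] add up to [2 * PI * eps], which
   is [eps] after division by the period. *)
destruct (goursat F s1 (s2 - s1)%C b) with (c := PI * eps) as [n Hn].
{ intros x y Hx Hy; unfold F.
  refine (ex_filterdiff_comp' (U := C_NormedModule) (V := C_NormedModule)
    (W := C_NormedModule) Cexp f _ _ _).
  - apply C_diff_Cexp.
  - apply Hf; rewrite Cmod_Cexp.
    apply Rle_lt_trans with rho; [|lra]; rewrite <- E2.
    replace (Re (par_point s1 (s2 - s1) b x y)) with (s1 + x * (s2 - s1))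
      by (unfold par_point, b, Re; simpl; ring).
    destruct (Rle_lt_or_eq_dec (s1 + x * (s2 - s1)) s2) as [H|H]; [nra| |].
    + left; now apply exp_increasing.
    + right; now f_equal. }
{ nra. }
specialize (Hn n (le_n n)); unfold rect in Hn.
replace (s1 + (s2 - s1))%C with (RtoC s2) in Hn by ring.
rewrite (trap_sym F n (s1 + b) (s2 + b)), trap_shift in Hn by exact HF.
rewrite (trap_sym F n s1 (s1 + b)) in Hn.
assert (R : Cmod (trap F n s2 (s2 + b)) <= Cmod (s2 + b - s2) * M).
{ apply (trap_bound (fun w => Re w = s2)).
  - apply midpoint_closed_Re.
  - intros w Hw; apply HM; now rewrite Cmod_Cexp, Hw.
  - reflexivity.
  - unfold b; simpl; ring. }
replace (s2 + b - s2)%C with b in R by ring; rewrite Hb in R.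
assert (L : Cmod (trap (fun w => F w - f 0%C)%C n s1 (s1 + b))
  <= Cmod (s1 + b - s1) * (eps / 2)).
{ apply (trap_bound (fun w => Re w = s1)).
  - apply midpoint_closed_Re.
  - intros w Hw; apply Hd'.
    replace (Cexp w - 0)%C with (Cexp w) by ring; rewrite Cmod_Cexp, Hw, E1.
    assert (H := Rmin_r rho (d / 2)); lra.
  - reflexivity.
  - unfold b; simpl; ring. }
rewrite (trap_minus F (fun _ => f 0%C)), trap_const in L.
replace (s1 + b - s1)%C with b in L by ring; rewrite Hb in L.
set (T1 := trap F n s1 (s1 + b)) in *; set (T2 := trap F n s2 (s2 + b)) in *.
set (B := trap F n s1 s2) in *.
replace (B + T2 + - B + - T1)%C with (T2 - T1)%C in Hn by ring.
assert (E : (f 0 * b = - (T1 - f 0 * b) - (T2 - T1) + T2)%C) by ring.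
assert (E' : Cmod (f 0%C) * (2 * PI) <= 2 * PI * (eps / 2) + PI * eps + 2 * PI * M).
{ rewrite <- Hb at 1; rewrite <- Cmod_mult, E.
  eapply Rle_trans; [apply Cmod_triangle|].
  apply Rplus_le_compat; [|exact R].
  eapply Rle_trans; [apply Cmod_triangle|].
  rewrite !Cmod_opp; lra. }
apply Rmult_le_reg_r with (2 * PI); lra.
Qed.

(* Coquelicot gives C two normed module structures, with the same norm and
   topology but different uniform balls. *)
Lemma filterdiff_C_AbsRing {V : NormedModule C_AbsRing} (f l : V -> C) F :
  filterdiff (V := C_NormedModule) f F l <->
  filterdiff (V := AbsRing_NormedModule C_AbsRing) f F l.
Proof.
split; intros [[H1 H2 H3] H4]; split; [now split | exact H4 | now split | exact H4].
Qed.

(** * Rules of complex differentiation *)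

Lemma ex_filterdiff_Cmult {V : NormedModule C_AbsRing} (f g : V -> C) x :
  ex_filterdiff (V := C_NormedModule) f (locally x) ->
  ex_filterdiff (V := C_NormedModule) g (locally x) ->
  ex_filterdiff (V := C_NormedModule) (fun y => f y * g y)%C (locally x).
Proof.
intros [lf Hf] [lg Hg].
eexists; apply filterdiff_C_AbsRing.
apply filterdiff_C_AbsRing in Hf, Hg.
exact (@filterdiff_mult_fct C_AbsRing V f g x lf lg Cmult_comm Hf Hg).
Qed.

Lemma C_diff_mult (f g : C -> C) p :
  C_diff f p -> C_diff g p -> C_diff (fun z => f z * g z)%C p.
Proof. exact (ex_filterdiff_Cmult (V := C_NormedModule) f g p). Qed.

Lemma C_diff_comp (f g : C -> C) p :
  C_diff f p -> C_diff g (f p) -> C_diff (fun z => g (f z)) p.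
Proof.
exact (ex_filterdiff_comp' (U := C_NormedModule) (V := C_NormedModule)
  (W := C_NormedModule) f g p).
Qed.

Lemma C_diff_inv (p : C) : p <> 0%C -> C_diff Cinv p.
Proof.
intros Hp; apply C_diff_eps; exists (- / (p * p))%C; intros eps He.
assert (Hp' : 0 < Cmod p) by now apply Cmod_gt_0.
set (m := Cmod p) in *.
(* The remainder is [(z - p)^2 / (z p^2)], of modulus at most [2 r^2 / m^3] once [|z| >= m / 2]. *)
exists (Rmin (m / 2) (eps * (m * m * m) / 2)); split.
{ apply Rmin_pos; [lra|]; assert (0 < m * m * m) by (repeat apply Rmult_lt_0_compat; lra); nra. }
intros z Hz; apply Rmin_Rgt_l in Hz; destruct Hz as [Hz1 Hz2].
assert (Hz : m / 2 <= Cmod z).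
{ assert (T := Cmod_triangle (- (z - p)) z); rewrite Cmod_opp in T.
  replace (- (z - p) + z)%C with p in T by ring; fold m in T; lra. }
assert (Hz0 : z <> 0%C) by (apply Cmod_gt_0; lra).
replace (/ z - / p - - / (p * p) * (z - p))%C
  with ((z - p) * (z - p) * / (z * (p * p)))%C by (field; now split).
rewrite !Cmod_mult, Cmod_inv, !Cmod_mult; [|repeat apply Cmult_neq_0; easy].
fold m; set (r := Cmod (z - p)) in *.
assert (Hr : 0 <= r) by apply Cmod_ge_0.
rewrite (Rmult_comm eps), Rmult_assoc; apply Rmult_le_compat_l; [exact Hr|].
apply Rle_trans with (r * / (m / 2 * (m * m))).
- apply Rmult_le_compat_l; [exact Hr|].
  apply Rinv_le_contravar; [|apply Rmult_le_compat_r]; nra.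
- apply Rmult_le_reg_r with (m / 2 * (m * m)); [nra|].
  rewrite Rmult_assoc, Rinv_l by nra; nra.
Qed.

(** Away from 0 this is the product rule. At 0 the function is [w] times the square of the
    difference quotient of [k], so first-order information on [k] suffices and the derivative is
    [l * l]. *)
Lemma C_diff_sqr_div (k : C -> C) (z : C) :
  (z = 0%C -> k z = 0%C) -> C_diff k z -> C_diff (fun w => k w * k w * / w)%C z.
Proof.
intros H0 Hk; destruct (Ceq_dec z 0%C) as [->|Hz].
- specialize (H0 eq_refl).
  apply C_diff_eps in Hk; destruct Hk as [l Hl]; apply C_diff_eps.
  exists (l * l)%C; intros eps He.
  assert (L := Cmod_ge_0 l).
  (* The remainder factors as [(k w - l w) (k w - l w + 2 l w) / w], at most [e (e + 2 |l|) |w|];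
     [e <= 1] bounds the bracket by [2 |l| + 1]. *)
  set (e := Rmin 1 (eps / (2 * Cmod l + 1))).
  assert (He0 : 0 < e) by (apply Rmin_pos; [lra | apply Rdiv_lt_0_compat; lra]).
  assert (He1 : e <= 1) by apply Rmin_l.
  assert (He2 : e * (2 * Cmod l + 1) <= eps).
  { apply Rle_trans with (eps / (2 * Cmod l + 1) * (2 * Cmod l + 1)).
    - apply Rmult_le_compat_r; [lra | apply Rmin_r].
    - right; field; lra. }
  destruct (Hl e He0) as [d [Hd Hd']].
  exists d; split; [exact Hd|]; intros w Hw; specialize (Hd' w Hw).
  rewrite H0 in *.
  replace (w - 0)%C with w in * by ring.
  replace (k w - 0 - l * w)%C with (k w - l * w)%C in Hd' by ring.
  destruct (Ceq_dec w 0%C) as [->|Hw0].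
  { rewrite H0; replace (_ - _ - _)%C with (RtoC 0) by ring.
    rewrite Cmod_0; lra. }
  rewrite !Cmult_0_l.
  replace (k w * k w * / w - 0 - l * l * w)%C
    with ((k w - l * w) * (k w - l * w + 2 * (l * w)) * / w)%C by (field; exact Hw0).
  rewrite !Cmod_mult, Cmod_inv by exact Hw0.
  set (r := Cmod w) in *.
  assert (Hr : 0 < r) by now apply Cmod_gt_0.
  assert (T := Cmod_triangle (k w - l * w) (2 * (l * w))).
  rewrite !Cmod_mult, Cmod_R, Rabs_pos_eq in T by lra; fold r in T.
  assert (D0 := Cmod_ge_0 (k w - l * w)).
  apply Rmult_le_reg_r with r; [exact Hr|].
  rewrite Rmult_assoc, Rinv_l, Rmult_1_r by lra.
  apply Rle_trans with (e * r * ((2 * Cmod l + 1) * r)).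
  + apply Rmult_le_compat; [easy | apply Cmod_ge_0 | easy |]; nra.
  + nra.
- apply (C_diff_mult (fun w => k w * k w)%C Cinv); [now apply C_diff_mult|].
  now apply C_diff_inv.
Qed.

Lemma C_diff_affine (a b p : C) : C_diff (fun z => a + b * z)%C p.
Proof.
apply C_diff_eps; exists b; intros eps He; exists 1; split; [lra|]; intros z _.
replace (_ - _ - _)%C with (RtoC 0) by ring.
rewrite Cmod_0; apply Rmult_le_pos; [lra | apply Cmod_ge_0].
Qed.

Lemma Cmod2_1_plus_scal (a : R) (z : C) :
  Cmod (1 + a * z) ^ 2 = 1 + 2 * a * Re z + a ^ 2 * Cmod z ^ 2.
Proof. rewrite !Cmod2_alt; destruct z as [x y]; simpl; ring. Qed.

Lemma Cmod2_plus_R (a : R) (z : C) :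
  Cmod (a + 1 * z) ^ 2 = Cmod z ^ 2 + 2 * a * Re z + a ^ 2.
Proof. rewrite !Cmod2_alt; destruct z as [x y]; simpl; ring. Qed.

(* [k z ^ 2 / z] is differentiable at 0 as well, so the mean value inequality
   applies to its composition with the Moebius map sending 0 to [a]. *)
Lemma weak_schwarz (k : C -> C) (M a : R) :
  (forall z, Cmod z < 1 -> C_diff k z) ->
  (forall z, Cmod z < 1 -> Cmod (k z) <= M) -> k 0%C = 0%C -> 0 < a < 1 ->
  Cmod (k a) ^ 2 <= a * M ^ 2.
Proof.
intros Hk HM H0 Ha.
set (phi := fun z : C => ((a + 1 * z) * / (1 + a * z))%C).
assert (Hden : forall z, Cmod z < 1 -> 0 < Cmod (1 + a * z)).
{ intros z Hz.
  assert (T := Cmod_triangle (1 + a * z) (- (a * z))).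
  replace (1 + a * z + - (a * z))%C with (RtoC 1) in T by ring.
  rewrite Cmod_1, Cmod_opp, Cmod_mult, Cmod_R, Rabs_pos_eq in T by lra.
  assert (Z := Cmod_ge_0 z); nra. }
assert (Hmod : forall z, Cmod z < 1 ->
  Cmod (phi z) * Cmod (1 + a * z) = Cmod (a + 1 * z)).
{ intros z Hz; specialize (Hden z Hz); unfold phi.
  rewrite Cmod_mult, Cmod_inv by (now apply Cmod_gt_0).
  rewrite Rmult_assoc, Rinv_l; lra. }
assert (Hphi : forall z, Cmod z < 1 -> Cmod (phi z) < 1).
{ intros z Hz.
  assert (E := Hmod z Hz); assert (D := Hden z Hz).
  assert (Z := Cmod_ge_0 z).
  assert (Z2 : Cmod z ^ 2 < 1) by nra.
  (* The identity behind this is [|1 + a z|^2 - |a + z|^2 = (1 - a^2) (1 - |z|^2)]. *)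
  assert (L : Cmod (a + 1 * z) ^ 2 < Cmod (1 + a * z) ^ 2).
  { assert (0 < (1 - a ^ 2) * (1 - Cmod z ^ 2)) by (apply Rmult_lt_0_compat; nra).
    rewrite Cmod2_1_plus_scal, Cmod2_plus_R; lra. }
  assert (P := Cmod_ge_0 (phi z)).
  rewrite <- E in L; apply Rnot_le_lt; intros H; apply (Rlt_not_le _ _ L).
  apply pow_incr; split; [lra|]; nra. }
assert (Hdphi : forall z, Cmod z < 1 -> C_diff phi z).
{ intros z Hz; apply (C_diff_mult (fun w => a + 1 * w)%C (fun w => / (1 + a * w))%C);
    [apply C_diff_affine|].
  apply (C_diff_comp (fun z : C => 1 + a * z)%C Cinv).
  - apply C_diff_affine.
  - apply C_diff_inv, Cmod_gt_0, Hden, Hz. }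
set (q := fun w => (k w * k w * / w)%C).
assert (Hq : forall z, Cmod z < 1 -> C_diff (fun z => q (phi z)) z).
{ intros z Hz.
  apply (C_diff_comp phi q).
  - now apply Hdphi.
  - apply C_diff_sqr_div; [intros E; now rewrite E | apply Hk, Hphi, Hz]. }
assert (HM0 : 0 <= M).
{ apply Rle_trans with (Cmod (k 0%C)); [apply Cmod_ge_0|].
  apply HM; rewrite Cmod_0; lra. }
assert (E0 : phi 0%C = a) by (unfold phi; field; intros H; apply RtoC_inj in H; lra).
assert (Main : forall t, 0 < t < 1 -> Cmod (k a) ^ 2 * t <= a * M ^ 2).
{ intros t Ht.
  (* On [|z|^2 = r2] one has [1 - |phi z|^2 = (1 - a^2) (1 - r2) / |1 + a z|^2] and
     [|1 + a z| >= 1 - a], so this choice forces [|phi z| >= t], hence [|q (phi z)| <= M^2 / t]. *)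
  set (r2 := 1 - (1 - t ^ 2) * (1 - a) ^ 2).
  assert (Hr2 : 0 < r2 < 1).
  { unfold r2; assert (0 < (1 - a) ^ 2 < 1) by nra.
    assert (0 < 1 - t ^ 2 < 1) by nra; nra. }
  assert (Hr := sqrt_lt_R0 r2 (proj1 Hr2)).
  assert (Hrr := pow2_sqrt r2 ltac:(lra)).
  assert (Hr1 : sqrt r2 < 1) by nra.
  assert (HI := mean_value_inequality (fun z => q (phi z)) (sqrt r2) (M ^ 2 / t)
    Hq (conj Hr Hr1)).
  cbv beta in HI; rewrite E0 in HI.
  assert (HB : forall z, Cmod z = sqrt r2 -> Cmod (q (phi z)) <= M ^ 2 / t).
  { intros z Hz.
    assert (Hz1 : Cmod z < 1) by lra.
    assert (Ht' : t <= Cmod (phi z)).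
    { assert (E := Hmod z Hz1); assert (D := Hden z Hz1).
      assert (L : (t * Cmod (1 + a * z)) ^ 2 <= Cmod (a + 1 * z) ^ 2).
      { rewrite Rpow_mult_distr, Cmod2_1_plus_scal, Cmod2_plus_R, Hz, Hrr.
        assert (X := re_le_Cmod z); apply Rabs_le_between in X.
        assert (Z2 := Cmod2_alt z); rewrite Hz, Hrr in Z2.
        assert (S1 : (1 - a) ^ 2 <= 1 + 2 * a * Re z + a ^ 2 * r2).
        { rewrite Z2.
          assert (0 <= a * (1 + Re z)) by (apply Rmult_le_pos; lra).
          assert ((1 - a) ^ 2 <= (1 + a * Re z) ^ 2) by (apply pow_incr; lra).
          assert (0 <= a ^ 2 * Im z ^ 2).
          { apply Rmult_le_pos; apply pow2_ge_0. }
          lra. }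
        set (m := 1 + 2 * a * Re z + a ^ 2 * r2) in *.
        replace (r2 + 2 * a * Re z + a ^ 2) with (m - (1 - a ^ 2) * (1 - r2))
          by (unfold m; ring).
        replace (1 - r2) with ((1 - t ^ 2) * (1 - a) ^ 2) by (unfold r2; ring).
        assert (0 <= (1 - t ^ 2)) by nra.
        assert (0 <= (1 - t ^ 2) * (m - (1 - a) ^ 2)) by (apply Rmult_le_pos; lra).
        assert (0 <= a ^ 2 * ((1 - t ^ 2) * (1 - a) ^ 2)).
        { repeat apply Rmult_le_pos; try apply pow2_ge_0; try lra; nra. }
        lra. }
      rewrite <- E in L.
      apply Rmult_le_reg_r with (Cmod (1 + a * z)); [exact D|].
      apply Rsqr_incr_0_var; [now rewrite !Rsqr_pow2|].
      rewrite E; apply Cmod_ge_0. }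
    assert (Hp0 : phi z <> 0%C) by (apply Cmod_gt_0; lra).
    unfold q; rewrite !Cmod_mult, Cmod_inv by exact Hp0.
    assert (B := HM _ (Hphi z Hz1)); assert (B0 := Cmod_ge_0 (k (phi z))).
    apply Rmult_le_compat.
    - nra.
    - left; apply Rinv_0_lt_compat; lra.
    - nra.
    - apply Rinv_le_contravar; lra. }
  specialize (HI HB); unfold q in HI.
  rewrite !Cmod_mult, Cmod_inv, Cmod_R, Rabs_pos_eq in HI;
    [|lra|intros H; apply RtoC_inj in H; lra].
  apply (Rmult_le_compat_r (a * t)) in HI; [|nra].
  replace (M ^ 2 / t * (a * t)) with (a * M ^ 2) in HI by (field; lra).
  eapply Rle_trans; [|exact HI]; right; field; lra. }
set (X := Cmod (k a) ^ 2) in *; set (Y := a * M ^ 2) in *.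
assert (HY : 0 <= Y) by (unfold Y; apply Rmult_le_pos; [lra | apply pow2_ge_0]).
apply Rnot_lt_le; intros H.
(* Replaces the limit [t -> 1]: for this [t] the product [X * t] is the mean of [X] and [Y], which
   exceeds [Y] if [Y < X]. *)
assert (Ht : 0 < (X + Y) / (2 * X) < 1).
{ split; [apply Rdiv_lt_0_compat; lra|].
  apply Rmult_lt_reg_r with (2 * X); [lra|].
  unfold Rdiv; rewrite Rmult_assoc, Rinv_l; lra. }
specialize (Main _ Ht).
replace (X * ((X + Y) / (2 * X))) with ((X + Y) / 2) in Main by (field; lra).
lra.
Qed.

(** * Complex series and l2 *)

Lemma ex_series_Re_Im (a : nat -> C) : ex_series (fun j => Cmod (a j)) ->
  ex_series (fun j => Re (a j)) /\ ex_series (fun j => Im (a j)).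
Proof.
intros H; split; apply ex_series_Rabs; apply ex_series_le_pos with (2 := H);
  intros j; (split; [apply Rabs_pos|]).
- apply re_le_Cmod.
- eapply Rle_trans; [|apply Rmax_Cmod]; apply Rmax_r.
Qed.

Lemma CSeries_ext (a b : nat -> C) : (forall j, a j = b j) -> CSeries a = CSeries b.
Proof.
intros H; unfold CSeries; f_equal; apply Series_ext; intros j; now rewrite H.
Qed.

Lemma CSeries_plus (a b : nat -> C) :
  ex_series (fun j => Cmod (a j)) -> ex_series (fun j => Cmod (b j)) ->
  CSeries (fun j => a j + b j)%C = (CSeries a + CSeries b)%C.
Proof.
intros Ha Hb; apply ex_series_Re_Im in Ha, Hb.
unfold CSeries, Cplus; simpl; f_equal; now apply Series_plus.
Qed.

Lemma CSeries_scal (k : C) (a : nat -> C) : ex_series (fun j => Cmod (a j)) ->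
  CSeries (fun j => k * a j)%C = (k * CSeries a)%C.
Proof.
intros Ha; apply ex_series_Re_Im in Ha; destruct Ha as [Hr Hi].
unfold CSeries, Cmult; simpl; f_equal.
- rewrite <- !Series_scal_l, <- Series_minus; [reflexivity| |].
  + exact (ex_series_scal (fst k) _ Hr).
  + exact (ex_series_scal (snd k) _ Hi).
- rewrite <- !Series_scal_l, <- Series_plus; [reflexivity| |].
  + exact (ex_series_scal (fst k) _ Hi).
  + exact (ex_series_scal (snd k) _ Hr).
Qed.

Lemma Cmod_CSeries_le (a : nat -> C) : ex_series (fun j => Cmod (a j)) ->
  Cmod (CSeries a) <= 2 * Series (fun j => Cmod (a j)).
Proof.
intros H; eapply Rle_trans; [apply Cmod_le_Rabs|].
assert (B : forall f : C -> R, (forall z, Rabs (f z) <= Cmod z) ->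
  Rabs (Series (fun j => f (a j))) <= Series (fun j => Cmod (a j))).
{ intros f Hf; eapply Rle_trans; [apply Series_Rabs|].
  - apply ex_series_le_pos with (2 := H).
    intros j; split; [apply Rabs_pos | apply Hf].
  - apply Series_le with (2 := H).
    intros j; split; [apply Rabs_pos | apply Hf]. }
assert (B1 := B Re re_le_Cmod).
assert (B2 := B Im ltac:(intros z; eapply Rle_trans; [|apply Rmax_Cmod]; apply Rmax_r)).
simpl; lra.
Qed.

(** * Changing one term, and the geometry of l2 *)

Definition update {T : Type} (a : nat -> T) (n : nat) (b : T) (j : nat) : T :=
  if Nat.eq_dec j n then b else a j.

Lemma update_map {T U : Type} (f : T -> U) (a : nat -> T) n b j :
  f (update a n b j) = update (fun i => f (a i)) n (f b) j.
Proof. unfold update; now destruct Nat.eq_dec. Qed.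

Lemma is_series_single (n : nat) (d : R) : is_series (update (fun _ => 0) n d) d.
Proof.
apply filterlim_ext_loc with (fun _ : nat => d); [|apply filterlim_const].
exists n; intros m Hm.
assert (E : forall k, (k < n)%nat -> sum_n (update (fun _ => 0) n d) k = 0).
{ induction k as [|k IH]; intros Hk.
  - rewrite sum_O; unfold update; destruct Nat.eq_dec; [lia | reflexivity].
  - rewrite sum_Sn, IH by lia; unfold update; destruct Nat.eq_dec; [lia|].
    apply Rplus_0_l. }
symmetry; induction Hm as [|m Hm IH].
- destruct n as [|n]; [rewrite sum_O | rewrite sum_Sn, E by lia];
    unfold update; (destruct Nat.eq_dec; [|lia]); [reflexivity | apply Rplus_0_l].
- rewrite sum_Sn, IH; unfold update; destruct Nat.eq_dec; [lia|].
  apply Rplus_0_r.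
Qed.

Lemma is_series_update (a : nat -> R) n b : ex_series a ->
  is_series (update a n b) (Series a + (b - a n)).
Proof.
intros H.
apply is_series_ext with (fun j => plus (a j) (update (fun _ => 0) n (b - a n) j)).
- intros j; unfold update; destruct Nat.eq_dec as [->|_];
    [change (a n + (b - a n) = b) | change (a j + 0 = a j)]; ring.
- apply (is_series_plus (V := R_NormedModule)); [|apply is_series_single].
  now apply Series_correct.
Qed.

Lemma CSeries_update (a : nat -> C) n b : ex_series (fun j => Cmod (a j)) ->
  CSeries (update a n b) = (CSeries a + (b - a n))%C.
Proof.
intros H; apply ex_series_Re_Im in H; destruct H as [Hr Hi].
unfold CSeries, Cplus, Cminus, Copp; simpl; f_equal.
- rewrite (Series_ext _ _ (update_map Re a n b)).
  exact (is_series_unique _ _ (is_series_update _ n (Re b) Hr)).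
- rewrite (Series_ext _ _ (update_map Im a n b)).
  exact (is_series_unique _ _ (is_series_update _ n (Im b) Hi)).
Qed.

Lemma l2_inner_summable (x v : l2) : ex_series (fun j => Cmod (x j * Cconj (v j))%C).
Proof.
apply ex_series_le_pos with (2 := ex_series_lin 1 1 x v).
intros j; split; [apply Cmod_ge_0|].
rewrite Cmod_mult, Cmod_conj.
assert (H := Cmod_ge_0 (x j)); assert (H' := Cmod_ge_0 (v j)).
assert (0 <= (Cmod (x j) - Cmod (v j)) ^ 2) by apply pow2_ge_0; nra.
Qed.

Lemma l2_inner_plus_l (x y v : l2) :
  l2_inner (l2_plus x y) v = (l2_inner x v + l2_inner y v)%C.
Proof.
unfold l2_inner; rewrite <- CSeries_plus by apply l2_inner_summable.
apply CSeries_ext; intros j; simpl l2_coord; ring.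
Qed.

Lemma l2_inner_scal_l (k : C) (x v : l2) :
  l2_inner (l2_scal k x) v = (k * l2_inner x v)%C.
Proof.
unfold l2_inner; rewrite <- CSeries_scal by apply l2_inner_summable.
apply CSeries_ext; intros j; simpl l2_coord; ring.
Qed.

(** The common source of Pythagoras, with [t] the inner product, and of Cauchy-Schwarz, with [t] the
    minimising coefficient [l2_inner x v / |v|^2]. *)
Lemma l2_norm_minus_scal (x v : l2) (t : C) :
  l2_norm (minus x (scal t v)) ^ 2 =
  l2_norm x ^ 2 - 2 * Re (Cconj t * l2_inner x v) + Cmod t ^ 2 * l2_norm v ^ 2.
Proof.
destruct (ex_series_Re_Im _ (l2_inner_summable x v)) as [Hr Hi].
rewrite !l2_norm_sqr.
assert (E : Re (Cconj t * l2_inner x v) =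
  Series (fun j => Re (Cconj t * (x j * Cconj (v j)))%C)).
{ unfold l2_inner; rewrite <- CSeries_scal by apply l2_inner_summable.
  reflexivity. }
rewrite E, <- !Series_scal_l, <- Series_minus, <- Series_plus.
- apply Series_ext; intros j.
  change ((minus x (scal t v) : l2) j) with (x j - t * v j)%C.
  rewrite !Cmod2_alt.
  destruct (x j) as [a b], (v j) as [c d], t as [p q]; simpl; ring.
- apply (ex_series_minus (V := R_NormedModule)); [apply l2_summable|].
  apply (ex_series_scal (V := R_NormedModule)), ex_series_Re_Im.
  apply ex_series_ext with (fun j => Cmod t * Cmod (x j * Cconj (v j))%C).
  + intros j; now rewrite (Cmod_mult (Cconj t)), Cmod_conj.
  + exact (ex_series_scal (Cmod t) _ (l2_inner_summable x v)).
- exact (ex_series_scal (Cmod t ^ 2) _ (l2_summable v)).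
- apply l2_summable.
- apply (ex_series_scal (V := R_NormedModule)), ex_series_Re_Im.
  apply ex_series_ext with (fun j => Cmod t * Cmod (x j * Cconj (v j))%C).
  + intros j; now rewrite (Cmod_mult (Cconj t)), Cmod_conj.
  + exact (ex_series_scal (Cmod t) _ (l2_inner_summable x v)).
Qed.

Lemma l2_norm_minus_proj (x v : l2) : l2_norm v = 1 ->
  l2_norm (minus x (scal (l2_inner x v) v)) ^ 2 =
  l2_norm x ^ 2 - Cmod (l2_inner x v) ^ 2.
Proof.
intros Hv; rewrite l2_norm_minus_scal, Hv, Cmod2_alt.
destruct (l2_inner x v) as [a b]; simpl; ring.
Qed.

Lemma l2_inner_le (x v : l2) : Cmod (l2_inner x v) <= l2_norm x * l2_norm v.
Proof.
assert (X := l2_norm_ge_0 x); assert (V := l2_norm_ge_0 v).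
destruct (Req_dec (l2_norm v) 0) as [H|H].
- apply l2_norm_eq_0 in H; subst v.
  replace (l2_inner x l2_zero) with (RtoC 0); [rewrite Cmod_0; nra|].
  unfold l2_inner; rewrite (CSeries_ext _ (fun j => 0 * (x j * Cconj (x j)))%C).
  + rewrite CSeries_scal by apply l2_inner_summable.
    symmetry; apply Cmult_0_l.
  + intros j; simpl; unfold Cconj; simpl.
    destruct (x j) as [a b]; unfold Cmult; simpl; f_equal; ring.
- assert (Hs := l2_norm_minus_scal x v (l2_inner x v / RtoC (l2_norm v ^ 2))%C).
  set (n := l2_norm v) in *; set (w := l2_inner x v) in *.
  assert (Hn : RtoC (n ^ 2) <> 0%C).
  { intros E; apply RtoC_inj in E; apply (pow_nonzero n 2 H E). }
  rewrite Cmod_div, Cmod_R, Rabs_pos_eq in Hs; [|apply pow2_ge_0|exact Hn].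
  assert (E : Re (Cconj (w / RtoC (n ^ 2)) * w) = Cmod w ^ 2 / n ^ 2).
  { rewrite Cmod2_alt; unfold Cdiv, Cconj, Cmult, Cinv; destruct w as [a b].
    simpl; field; easy. }
  rewrite E in Hs.
  replace (l2_norm x ^ 2 - 2 * (Cmod w ^ 2 / n ^ 2) + (Cmod w / n ^ 2) ^ 2 * n ^ 2)
    with (l2_norm x ^ 2 - Cmod w ^ 2 / n ^ 2) in Hs by (field; exact H).
  assert (P := pow2_ge_0 (l2_norm (minus x (scal (w / RtoC (n ^ 2))%C v)))).
  rewrite Hs in P.
  apply Rsqr_incr_0_var; [|nra]; rewrite !Rsqr_pow2.
  assert (N2 : 0 < n ^ 2) by nra.
  replace (Cmod w ^ 2) with (Cmod w ^ 2 / n ^ 2 * n ^ 2) by (field; exact H).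
  nra.
Qed.

Lemma l2_inner_self (x : l2) : l2_inner x x = RtoC (l2_norm x ^ 2).
Proof.
rewrite l2_norm_sqr; unfold l2_inner, CSeries, RtoC; f_equal.
- apply Series_ext; intros j; now rewrite <- Cmod2_conj.
- rewrite (Series_ext _ (fun j => 0 * Cmod (x j) ^ 2)).
  + rewrite Series_scal_l; apply Rmult_0_l.
  + intros j; rewrite <- Cmod2_conj, Rmult_0_l; reflexivity.
Qed.

Lemma is_linear_l2_inner (v : l2) :
  is_linear (U := l2_NormedModule) (V := C_NormedModule) (fun x => l2_inner x v).
Proof.
split.
- intros x y; apply l2_inner_plus_l.
- intros k x; apply l2_inner_scal_l.
- exists (l2_norm v + 1); split; [assert (H := l2_norm_ge_0 v); lra|].
  intros x; change (Cmod (l2_inner x v) <= (l2_norm v + 1) * l2_norm x).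
  assert (H := l2_inner_le x v); assert (X := l2_norm_ge_0 x); nra.
Qed.

Lemma unit_summable (n : nat) :
  ex_series (fun j => Cmod (update (fun _ => RtoC 0) n (RtoC 1) j) ^ 2).
Proof.
exists 1; apply is_series_ext with (2 := is_series_single n 1).
intros j; rewrite (update_map (fun z => Cmod z ^ 2)).
unfold update; destruct Nat.eq_dec; rewrite ?Cmod_1, ?Cmod_0; symmetry;
  [apply pow1 | apply pow_i; lia].
Qed.

Definition l2_unit (n : nat) : l2 := mk_l2 _ (unit_summable n).

(** Written with linear operations, so that summability is automatic and holomorphic dependence on
    [x] and [b] follows from the sum and chain rules. *)
Definition l2_update (x : l2) (n : nat) (b : C) : l2 :=
  l2_plus x (l2_scal (b - x n) (l2_unit n)).

Lemma l2_update_coord (x : l2) n b j : l2_update x n b j = update x n b j.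
Proof.
simpl; unfold update; destruct Nat.eq_dec as [->|_]; ring.
Qed.

Lemma l2_update_norm (x : l2) n b :
  l2_norm (l2_update x n b) ^ 2 = l2_norm x ^ 2 + (Cmod b ^ 2 - Cmod (x n) ^ 2).
Proof.
rewrite !l2_norm_sqr.
rewrite (Series_ext _ (update (fun j => Cmod (x j) ^ 2) n (Cmod b ^ 2))).
- exact (is_series_unique _ _ (is_series_update _ n _ (l2_summable x))).
- intros j; rewrite l2_update_coord; apply (update_map (fun z => Cmod z ^ 2)).
Qed.

(** Erasing the coordinate leaves a vector whose squared norm is still nonnegative. *)
Lemma l2_coord_le (x : l2) n : Cmod (x n) <= l2_norm x.
Proof.
assert (H := l2_update_norm x n 0%C); rewrite Cmod_0 in H.
assert (P := pow2_ge_0 (l2_norm (l2_update x n 0%C))).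
apply Rsqr_incr_0_var; [rewrite !Rsqr_pow2; lra | apply l2_norm_ge_0].
Qed.

Lemma l2_update_inner (x v : l2) n b :
  l2_inner (l2_update x n b) v = (l2_inner x v + (b - x n) * Cconj (v n))%C.
Proof.
unfold l2_inner.
rewrite (CSeries_ext _ (update (fun j => x j * Cconj (v j)) n (b * Cconj (v n)))%C).
- rewrite CSeries_update by apply l2_inner_summable; ring.
- intros j; rewrite l2_update_coord; unfold update; now destruct Nat.eq_dec as [->|_].
Qed.

(** * Power sums on the unit ball *)

Lemma l2_pow_le (x : l2) N j : (2 <= N)%nat -> l2_norm x <= 1 ->
  Cmod (x j ^ N)%C <= Cmod (x j) ^ 2.
Proof.
intros HN Hx; rewrite Cmod_pow.
assert (H := l2_coord_le x j); assert (H0 := Cmod_ge_0 (x j)).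
replace N with (2 + (N - 2))%nat by lia; rewrite pow_add.
rewrite <- (Rmult_1_r (Cmod (x j) ^ 2)) at 2.
apply Rmult_le_compat_l; [apply pow2_ge_0|].
rewrite <- (pow1 (N - 2)); apply pow_incr; lra.
Qed.

Lemma l2_pow_summable (x : l2) N : (2 <= N)%nat -> l2_norm x <= 1 ->
  ex_series (fun j => Cmod (x j ^ N)%C).
Proof.
intros HN Hx; apply ex_series_le_pos with (2 := l2_summable x).
intros j; split; [apply Cmod_ge_0 | now apply l2_pow_le].
Qed.

Lemma l2_pow_sum_le (x : l2) N : (2 <= N)%nat -> l2_norm x <= 1 ->
  Cmod (CSeries (fun j => x j ^ N)%C) <= 2.
Proof.
intros HN Hx; eapply Rle_trans; [now apply Cmod_CSeries_le, l2_pow_summable|].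
assert (H : Series (fun j => Cmod (x j ^ N)%C) <= l2_norm x ^ 2).
{ rewrite l2_norm_sqr; apply Series_le; [|apply l2_summable].
  intros j; split; [apply Cmod_ge_0 | now apply l2_pow_le]. }
assert (H0 := l2_norm_ge_0 x); nra.
Qed.

Lemma l2_update_pow_sum (x : l2) N n b (r : R) :
  (2 <= N)%nat -> l2_norm x <= 1 ->
  CSeries (fun j => l2_scal r (l2_update x n b) j ^ N)%C =
  (RtoC (r ^ N) * (CSeries (fun j => x j ^ N) + (b ^ N - x n ^ N)))%C.
Proof.
intros HN Hx; assert (H := l2_pow_summable x N HN Hx).
rewrite (CSeries_ext _ (fun j => RtoC (r ^ N) * update (fun i => x i ^ N) n (b ^ N) j)%C).
- rewrite CSeries_scal.
  + now rewrite CSeries_update.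
  + exists (Series (fun j => Cmod (x j ^ N)%C) + (Cmod (b ^ N)%C - Cmod (x n ^ N)%C)).
    apply is_series_ext with (2 := is_series_update _ n (Cmod (b ^ N)%C) H).
    intros j; symmetry; apply (update_map Cmod).
- intros j; change (l2_scal r (l2_update x n b) j) with (r * l2_update x n b j)%C.
  rewrite l2_update_coord, Cpow_mult_l, RtoC_pow.
  now rewrite (update_map (fun z => z ^ N)%C).
Qed.

Lemma l2_coord_lim (x : l2) : is_lim_seq (fun n => Cmod (x n)) 0.
Proof.
apply is_lim_seq_ext with (fun n => sqrt (Cmod (x n) ^ 2)).
- intros n; apply sqrt_pow2, Cmod_ge_0.
- rewrite <- sqrt_0; apply is_lim_seq_continuous.
  + apply continuity_pt_sqrt; lra.
  + exact (ex_series_lim_0 _ (l2_summable x)).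
Qed.

Lemma is_linear_l2_coord (n : nat) :
  is_linear (U := l2_NormedModule) (V := C_NormedModule) (fun x : l2 => x n).
Proof.
split; [reflexivity | reflexivity |].
exists 1; split; [lra|]; intros x; rewrite Rmult_1_l; apply l2_coord_le.
Qed.

Lemma is_linear_scal_vector {V : NormedModule C_AbsRing} (v : V) :
  is_linear (U := C_NormedModule) (V := V) (fun k : C => scal (k : C_AbsRing) v).
Proof.
split.
- intros x y; exact (scal_distr_r (x : C_AbsRing) (y : C_AbsRing) v).
- intros k x; symmetry; exact (scal_assoc (k : C_AbsRing) (x : C_AbsRing) v).
- exists (norm v + 1); split; [assert (H := norm_ge_0 v); lra|].
  intros k; eapply Rle_trans; [apply norm_scal|].
  change (Cmod k * norm v <= (norm v + 1) * Cmod k).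
  assert (H := Cmod_ge_0 k); lra.
Qed.

(** * Bounded holomorphic maps and cluster sets *)

Lemma ex_filterdiff_Cplus {V : NormedModule C_AbsRing} (f g : V -> C) x :
  ex_filterdiff (V := C_NormedModule) f (locally x) ->
  ex_filterdiff (V := C_NormedModule) g (locally x) ->
  ex_filterdiff (V := C_NormedModule) (fun y => f y + g y)%C (locally x).
Proof.
intros [lf Hf] [lg Hg].
eexists; exact (filterdiff_plus_fct (V := C_NormedModule) _ _ _ _ Hf Hg).
Qed.

Lemma ex_filterdiff_Cconst {V : NormedModule C_AbsRing} (c : C) (x : V) :
  ex_filterdiff (V := C_NormedModule) (fun _ => c) (locally x).
Proof. eexists; apply filterdiff_const. Qed.

Lemma ex_filterdiff_Cpow {V : NormedModule C_AbsRing} (f : V -> C) x (N : nat) :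
  ex_filterdiff (V := C_NormedModule) f (locally x) ->
  ex_filterdiff (V := C_NormedModule) (fun y => f y ^ N)%C (locally x).
Proof.
intros Hf; induction N as [|N IH].
- exact (ex_filterdiff_Cconst (RtoC 1) x).
- exact (ex_filterdiff_Cmult f (fun y => f y ^ N)%C x Hf IH).
Qed.

Lemma ex_filterdiff_is_linear {V W : NormedModule C_AbsRing} (l : V -> W) x :
  is_linear l -> ex_filterdiff l (locally x).
Proof. intros H; exists l; now apply filterdiff_linear. Qed.

(* Slicing along a unit vector and pairing with [h z] reduces to one variable. *)
Lemma Hinf_weak_schwarz (h : Hinf_l2) (z : l2) : h l2_zero = l2_zero ->
  l2_norm z < 1 -> l2_norm (h z) ^ 2 <= l2_norm z * Hinf_norm h ^ 2.
Proof.
intros H0 Hz.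
assert (Z := l2_norm_ge_0 z); assert (Hn := l2_norm_ge_0 (h z)).
destruct (Req_dec (l2_norm z) 0) as [E|E].
{ apply l2_norm_eq_0 in E; rewrite E, H0.
  assert (E0 : l2_norm l2_zero = 0) by apply (norm_zero (V := l2_NormedModule)).
  rewrite E0; lra. }
destruct (Req_dec (l2_norm (h z)) 0) as [En|En].
{ rewrite En; simpl; assert (P := pow2_ge_0 (Hinf_norm h)); nra. }
set (s := l2_norm z) in *; set (n := l2_norm (h z)) in *.
assert (Hs : RtoC s <> 0%C) by (intros H; apply RtoC_inj in H; lra).
set (e := l2_scal (/ s)%C z).
assert (He : l2_norm e <= 1).
{ eapply Rle_trans; [apply l2_norm_scal|].
  rewrite Cmod_inv, Cmod_R, Rabs_pos_eq by (exact Hs || lra).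
  fold s; right; field; lra. }
assert (Hball : forall w : C, Cmod w < 1 ->
  open_unit_ball (V := l2_NormedModule) (l2_scal w e)).
{ intros w Hw; eapply Rle_lt_trans; [apply l2_norm_scal|].
  assert (W := Cmod_ge_0 w); nra. }
assert (B := fun x Hx => Hinf_norm_ge h x Hx : l2_norm (h x) <= Hinf_norm h).
assert (HH : 0 <= Hinf_norm h).
{ eapply Rle_trans; [exact Hn | apply B; exact Hz]. }
(* Pairing with [h z] itself gives [k s = n^2], while [|k|] is at most [Hinf_norm h * n]; the
   surplus factor [n^2] is cancelled at the end. *)
set (k := fun w : C => l2_inner (h (l2_scal w e)) (h z)).
assert (Hk := weak_schwarz k (Hinf_norm h * n) s).
assert (Ek : k (RtoC s) = RtoC (n ^ 2)).
{ unfold k; replace (l2_scal (RtoC s) e) with z; [apply l2_inner_self|].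
  apply l2_ext; intros j; simpl; field; exact Hs. }
rewrite Ek, Cmod_R, Rabs_pos_eq in Hk by apply pow2_ge_0.
assert (X : (n ^ 2) ^ 2 <= s * (Hinf_norm h * n) ^ 2).
{ apply Hk; [| | |lra].
  - intros w Hw; unfold k, C_diff.
    apply (ex_filterdiff_comp' (U := C_NormedModule) (V := l2_NormedModule)
      (W := C_NormedModule) (fun w : C => h (l2_scal w e)) (fun x => l2_inner x (h z))).
    + apply (ex_filterdiff_comp' (U := C_NormedModule) (V := l2_NormedModule)
        (W := l2_NormedModule) (fun w : C => l2_scal w e) h).
      * apply ex_filterdiff_is_linear.
        apply (is_linear_scal_vector (V := l2_NormedModule) e).
      * apply (Hinf_holo h), Hball, Hw.
    + apply ex_filterdiff_is_linear, is_linear_l2_inner.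
  - intros w Hw; unfold k; eapply Rle_trans; [apply l2_inner_le|].
    apply Rmult_le_compat_r; [exact Hn | apply B, Hball, Hw].
  - unfold k; replace (l2_scal 0 e) with l2_zero.
    + rewrite H0, <- (l2_plus_opp l2_zero) at 1.
      replace (l2_opp l2_zero) with (l2_scal (- (1)) l2_zero)
        by (apply l2_ext; intros j; simpl; ring).
      rewrite l2_inner_plus_l, l2_inner_scal_l; ring.
    + apply l2_ext; intros j; simpl; ring. }
assert (N2 : 0 < n ^ 2) by nra.
apply Rmult_le_reg_r with (n ^ 2); [exact N2|].
replace (n ^ 2 * n ^ 2) with ((n ^ 2) ^ 2) by ring.
eapply Rle_trans; [exact X|]; right; ring.
Qed.

Section Restriction.
Context {V W : NormedModule C_AbsRing} (f : V -> W)
  (f_holo : holomorphic_on open_unit_ball f)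
  (f_bounded : exists M : R, forall x, open_unit_ball x -> norm (f x) <= M).

Definition restrict (x : V) : W := if Rlt_dec (norm x) 1 then f x else zero.

Lemma restrict_in x : open_unit_ball x -> restrict x = f x.
Proof using Type. unfold restrict; now destruct Rlt_dec. Qed.

Lemma restrict_out x : ~ open_unit_ball x -> restrict x = zero.
Proof using Type. unfold restrict; now destruct Rlt_dec. Qed.

Lemma restrict_holo : holomorphic_on open_unit_ball restrict.
Proof using f_holo.
intros x Hx; apply ex_filterdiff_ext_locally with f; [|now apply f_holo].
apply filter_imp with (2 := locally_open_unit_ball x Hx).
intros y Hy; symmetry; now apply restrict_in.
Qed.

Lemma restrict_bounded : exists M : R,
  forall x, open_unit_ball x -> norm (restrict x) <= M.
Proof using f_bounded.
destruct f_bounded as [M HM]; exists M; intros x Hx.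
rewrite restrict_in by exact Hx; now apply HM.
Qed.

Definition Hinf_of : Hinf V W :=
  mk_Hinf restrict restrict_holo restrict_bounded restrict_out.

End Restriction.

(** * Sequences witnessing cluster points *)

Lemma C_filterlim_bound (u : nat -> C) (l : C) (e : nat -> R) :
  (forall n, Cmod (u n - l) <= e n) -> is_lim_seq e 0 ->
  filterlim u eventually (locally l).
Proof.
intros H He P HP.
apply (locally_norm_le_locally (V := C_NormedModule)) in HP.
destruct HP as [d Hd].
apply is_lim_seq_spec in He; destruct (He d) as [n0 Hn].
exists n0; intros n Hnn; apply Hd.
specialize (Hn n Hnn); rewrite Rminus_0_r in Hn.
change (Cmod (u n - l) < d).
apply Rle_lt_trans with (1 := H n), Rle_lt_trans with (2 := Hn), Rle_abs.
Qed.

(** The 2 makes every term, including the one at [n = 0], lie strictly between 0 and 1. *)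
Definition shrink (n : nat) : R := 1 - / (INR n + 2).

Lemma shrink_bounds n : 0 < shrink n < 1.
Proof.
unfold shrink; assert (H := pos_INR n).
assert (0 < / (INR n + 2)) by (apply Rinv_0_lt_compat; lra).
assert (/ (INR n + 2) <= / 2) by (apply Rinv_le_contravar; lra).
lra.
Qed.

Lemma shrink_lim : is_lim_seq shrink 1.
Proof.
unfold shrink; replace (Finite 1) with (Rbar_minus 1 0) by (simpl; f_equal; ring).
apply is_lim_seq_minus'; [apply is_lim_seq_const|].
apply (is_lim_seq_inv _ p_infty); [|discriminate].
apply is_lim_seq_plus with p_infty 2; [apply is_lim_seq_INR | apply is_lim_seq_const | easy].
Qed.

Lemma shrink_pow_lim k : is_lim_seq (fun n => 1 - shrink n ^ k) 0.
Proof.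
replace (Finite 0) with (Rbar_minus 1 1) by (simpl; f_equal; ring).
apply is_lim_seq_minus'; [apply is_lim_seq_const|].
induction k as [|k IH]; [apply is_lim_seq_const|].
simpl; replace 1 with (1 * 1) by ring.
apply is_lim_seq_mult'; [apply shrink_lim | exact IH].
Qed.

(** Serves both limits in the cluster set: [k = 1] for the pairings with a vector, [k = N] for the
    values of the [N]-homogeneous [f0]. *)
Lemma C_filterlim_shrink (u : nat -> C) (l : C) (k : nat) (d : nat -> C) (e : nat -> R) :
  (forall n, u n = (RtoC (shrink n ^ k) * (l + d n))%C) ->
  (forall n, Cmod (d n) <= e n) -> is_lim_seq e 0 ->
  filterlim u eventually (locally l).
Proof.
intros Hu Hd He.
apply C_filterlim_bound with (fun n => Cmod l * (1 - shrink n ^ k) + e n).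
- intros n; rewrite Hu.
  assert (B := shrink_bounds n).
  assert (0 <= shrink n ^ k) by (apply pow_le; lra).
  assert (shrink n ^ k <= 1) by (rewrite <- (pow1 k); apply pow_incr; lra).
  replace (_ - l)%C with (- (l * RtoC (1 - shrink n ^ k)) + RtoC (shrink n ^ k) * d n)%C
    by (rewrite RtoC_minus; ring).
  eapply Rle_trans; [apply Cmod_triangle|].
  rewrite Cmod_opp, !Cmod_mult, !Cmod_R, !Rabs_pos_eq by lra.
  assert (D := Cmod_ge_0 (d n)); specialize (Hd n); nra.
- replace (Finite 0) with (Finite (Cmod l * 0 + 0)) by (f_equal; ring).
  apply is_lim_seq_plus'; [|exact He].
  apply is_lim_seq_mult'; [apply is_lim_seq_const | apply shrink_pow_lim].
Qed.

(* The [n]-th coordinate of [g] is overwritten by [c]; the factor [shrink n]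
   keeps the map in the open unit ball. *)
Lemma cluster_set_perturb (N : nat) (hN : (2 <= N)%nat) (f0 : l2 -> C)
    (f0E : forall x : l2, open_unit_ball x -> f0 x = CSeries (fun j => (x j ^ N)%C))
    (g : Hinf_l2) (g_ball : forall y : l2, open_unit_ball y -> open_unit_ball (g y))
    (c : l2 -> C)
    (c_holo : holomorphic_on (V := l2_NormedModule) (W := C_NormedModule)
      open_unit_ball c)
    (gc : forall y : l2, open_unit_ball y -> l2_norm (g y) ^ 2 + Cmod (c y) ^ 2 <= 1)
    (h : Hinf_scalar)
    (hE : forall y : l2, open_unit_ball y -> h y = (f0 (g y) + c y ^ N)%C) :
  cluster_set f0 g h.
Proof.
set (G := fun (n : nat) (y : l2) => l2_scal (shrink n) (l2_update (g y) n (c y))).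
assert (Gn : forall n y, open_unit_ball y -> l2_norm (G n y) <= shrink n).
{ intros n y Hy; unfold G; assert (B := shrink_bounds n).
  eapply Rle_trans; [apply l2_norm_scal|].
  rewrite Cmod_R, Rabs_pos_eq by lra.
  assert (U := l2_update_norm (g y) n (c y)); specialize (gc y Hy).
  assert (P := pow2_ge_0 (Cmod (g y n))).
  assert (Q := l2_norm_ge_0 (l2_update (g y) n (c y))).
  assert (l2_norm (l2_update (g y) n (c y)) <= 1).
  { apply Rsqr_incr_0_var; [rewrite !Rsqr_pow2; lra | lra]. }
  nra. }
assert (G_holo : forall n, holomorphic_on (V := l2_NormedModule) (W := l2_NormedModule)
  open_unit_ball (G n)).
{ intros n y Hy; unfold G, l2_update.
  destruct (Hinf_holo g y Hy) as [lg Hg].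
  assert (Hd : ex_filterdiff (U := l2_NormedModule) (V := C_NormedModule)
    (fun y => c y - g y n)%C (locally y)).
  { destruct (c_holo y Hy) as [lc Hc].
    eexists; apply (filterdiff_minus_fct (V := C_NormedModule)); [exact Hc|].
    apply (filterdiff_comp' (U := l2_NormedModule) (V := l2_NormedModule)
      (W := C_NormedModule) g (fun x : l2 => x n)); [exact Hg|].
    apply filterdiff_linear, is_linear_l2_coord. }
  destruct (ex_filterdiff_comp' (U := l2_NormedModule) (V := C_NormedModule)
    (W := l2_NormedModule) _ (fun k : C => l2_scal k (l2_unit n)) y Hd
    (ex_filterdiff_is_linear _ _ (is_linear_scal_vector (V := l2_NormedModule) (l2_unit n))))
    as [ld Hld].
  eexists; apply (filterdiff_scal_r_fct (V := l2_NormedModule) (RtoC (shrink n) : C_AbsRing));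
    [exact Cmult_comm|].
  exact (filterdiff_plus_fct (V := l2_NormedModule) _ _ _ _ Hg Hld). }
assert (G_bounded : forall n, exists M : R, forall y : l2_NormedModule,
  open_unit_ball y -> norm (G n y : l2_NormedModule) <= M).
{ intros n; exists (shrink n); exact (Gn n). }
set (GG := fun n => Hinf_of (V := l2_NormedModule) (W := l2_NormedModule)
  (G n) (G_holo n) (G_bounded n) : Hinf_l2).
assert (GGE : forall n y, open_unit_ball y -> GG n y = G n y).
{ intros n y Hy; exact (restrict_in (V := l2_NormedModule) (W := l2_NormedModule) (G n) y Hy). }
assert (gn : forall n y, open_unit_ball y -> Cmod (g y n) <= 1 /\ Cmod (c y) <= 1).
{ intros n y Hy; specialize (gc y Hy); assert (L := l2_coord_le (g y) n).
  assert (P := l2_norm_ge_0 (g y)); assert (Q := Cmod_ge_0 (c y)).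
  assert (P2 := pow2_ge_0 (l2_norm (g y))); assert (Q2 := pow2_ge_0 (Cmod (c y))).
  split; nra. }
exists nat, le, GG; split; [|split; [|split]].
- split; [exact (inhabits O) | apply Nat.le_refl | intros a b d; apply Nat.le_trans |].
  intros a b; exists (a + b)%nat; lia.
- intros n; assert (B := shrink_bounds n).
  apply Rle_lt_trans with (shrink n); [|lra].
  apply Hinf_norm_le; intros y Hy; rewrite (GGE n y Hy); now apply Gn.
(* Overwriting coordinate [n] changes the pairing by a bounded factor times the conjugate of [v n],
   which tends to 0. *)
- intros y Hy v.
  apply (C_filterlim_shrink _ (l2_inner (g y) v) 1
    (fun n => (c y - g y n) * Cconj (v n))%C (fun n => 2 * Cmod (v n))).
  + intros n; rewrite (GGE n y Hy); unfold G.
    rewrite l2_inner_scal_l, l2_update_inner, pow_1; reflexivity.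
  + intros n; rewrite Cmod_mult, Cmod_conj.
    apply Rmult_le_compat_r; [apply Cmod_ge_0|].
    eapply Rle_trans; [apply Cmod_triangle|]; rewrite Cmod_opp.
    destruct (gn n y Hy); lra.
  + replace (Finite 0) with (Finite (2 * 0)) by (f_equal; ring).
    apply is_lim_seq_mult'; [apply is_lim_seq_const | apply l2_coord_lim].
(* In the power sum the new term [c y ^ N] does not depend on its position [n]; the lost term
   [g y n ^ N] tends to 0. *)
- intros y Hy; rewrite (hE y Hy).
  assert (Hgy := g_ball y Hy).
  assert (Hgy1 : l2_norm (g y) <= 1) by (left; exact Hgy).
  apply (C_filterlim_shrink _ (f0 (g y) + c y ^ N)%C N
    (fun n => - (g y n ^ N))%C (fun n => Cmod (g y n))).
  + intros n; rewrite (GGE n y Hy).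
    assert (Hb : open_unit_ball (G n y)).
    { apply Rle_lt_trans with (1 := Gn n y Hy); apply shrink_bounds. }
    rewrite (f0E _ Hb), (f0E _ Hgy); unfold G.
    rewrite l2_update_pow_sum by assumption; ring.
  + intros n; rewrite Cmod_opp.
    eapply Rle_trans; [now apply l2_pow_le|].
    destruct (gn n y Hy) as [H _]; assert (H0 := Cmod_ge_0 (g y n)); nra.
  + apply l2_coord_lim.
Qed.

Lemma op_norm_contraction (P : l2 -> l2) : is_linear P -> Rbar_le (op_norm P) 1 ->
  forall z, l2_norm (P z) <= l2_norm z.
Proof.
intros HP Hop z.
assert (H1 : forall x : l2, l2_norm x <= 1 -> l2_norm (P x) <= 1).
{ intros x Hx.
  assert (L := proj1 (Lub_Rbar_correct
    (fun r => exists x : l2, norm x <= 1 /\ r = norm (P x)))).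
  exact (Rbar_le_trans (l2_norm (P x)) _ 1 (L _ (ex_intro _ x (conj Hx eq_refl))) Hop). }
destruct (Req_dec (l2_norm z) 0) as [E|E].
- apply l2_norm_eq_0 in E; subst z.
  right; f_equal; exact (linear_zero P HP).
- assert (Z := l2_norm_ge_0 z); set (s := l2_norm z) in *.
  assert (Hs : RtoC s <> 0%C) by (intros H; apply RtoC_inj in H; lra).
  set (x := l2_scal (/ s)%C z).
  assert (Hx : l2_norm x <= 1).
  { eapply Rle_trans; [apply l2_norm_scal|].
    rewrite Cmod_inv, Cmod_R, Rabs_pos_eq by (exact Hs || lra).
    fold s; right; field; lra. }
  assert (Ez : z = scal (RtoC s : C_AbsRing) x).
  { apply l2_ext; intros j; simpl; field; exact Hs. }
  rewrite Ez, (linear_scal P HP); eapply Rle_trans; [apply l2_norm_scal|].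
  rewrite Cmod_R, Rabs_pos_eq by exact Z; specialize (H1 x Hx); nra.
Qed.

(** * Injectivity of the power map near 1 *)

(** Induction on [Y^(k+1) - 1 = (Y - 1) Y^k + (Y^k - 1)]; the condition [k e <= 1/2] keeps [|Y^k|]
    at most 2. *)
Lemma Cpow_near_1 (Y : C) e : Cmod (Y - 1) <= e -> forall k, INR k * e <= / 2 ->
  Cmod (Y ^ k)%C <= 1 + 2 * INR k * e /\ Cmod (Y ^ k - 1)%C <= 2 * INR k * e.
Proof.
intros HY.
assert (He : 0 <= e) by (eapply Rle_trans; [apply Cmod_ge_0 | exact HY]).
assert (T : forall z : C, Cmod z <= 1 + Cmod (z - 1)).
{ intros z; assert (H := Cmod_triangle 1 (z - 1)).
  rewrite Cmod_1 in H; now replace (1 + (z - 1))%C with z in H by ring. }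
assert (K : forall k, INR k * e <= / 2 -> Cmod (Y ^ k - 1)%C <= 2 * INR k * e).
{ induction k as [|k IH]; intros Hk.
  - simpl; replace (1 - 1)%C with (RtoC 0) by ring; rewrite Cmod_0; lra.
  - rewrite S_INR in *; specialize (IH ltac:(lra)).
    replace (Y ^ S k - 1)%C with ((Y - 1) * Y ^ k + (Y ^ k - 1))%C by (simpl; ring).
    eapply Rle_trans; [apply Cmod_triangle|]; rewrite Cmod_mult.
    assert (B := T (Y ^ k)%C); assert (B0 := Cmod_ge_0 (Y ^ k)%C).
    assert (B1 := Cmod_ge_0 (Y - 1)); nra. }
intros k Hk; specialize (K k Hk); specialize (T (Y ^ k)%C); lra.
Qed.

(** The function [t^k - k t] has a small Lipschitz constant near 1, as its derivative vanishes
    there. The induction proves this algebraically, without integrating a derivative. *)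
Lemma Cpow_minus_near_1 (X Y : C) e : Cmod (X - 1) <= e -> Cmod (Y - 1) <= e ->
  forall k, INR k * e <= / 8 ->
  Cmod (X ^ k - Y ^ k - INR k * (X - Y))%C <= 4 * INR k ^ 2 * e * Cmod (X - Y).
Proof.
intros HX HY.
assert (He : 0 <= e) by (eapply Rle_trans; [apply Cmod_ge_0 | exact HY]).
assert (D := Cmod_ge_0 (X - Y)).
induction k as [|k IH]; intros Hk.
- replace (_ - _ - _)%C with (RtoC 0) by (simpl; ring); rewrite Cmod_0; simpl; lra.
- rewrite S_INR in *; specialize (IH ltac:(lra)).
  assert (K0 := pos_INR k).
  assert (K1 : 0 <= INR k * e) by now apply Rmult_le_pos.
  destruct (Cpow_near_1 Y e HY k ltac:(lra)) as [_ HYk].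
  destruct (Cpow_near_1 X e HX 1%nat ltac:(simpl; lra)) as [HX1 _].
  rewrite Cpow_1_r in HX1; simpl INR in HX1.
  rewrite RtoC_plus.
  replace (X ^ S k - Y ^ S k - (INR k + 1) * (X - Y))%C
    with (X * (X ^ k - Y ^ k - INR k * (X - Y)) + INR k * (X - 1) * (X - Y)
      + (X - Y) * (Y ^ k - 1))%C by (simpl; ring).
  eapply Rle_trans; [apply Cmod_triangle|].
  eapply Rle_trans; [apply Rplus_le_compat_r, Cmod_triangle|].
  rewrite !Cmod_mult, Cmod_R, Rabs_pos_eq by exact K0.
  set (d := Cmod (X - Y)) in *; set (r := INR k) in *.
  assert (A1 : Cmod X * Cmod (X ^ k - Y ^ k - r * (X - Y)) <=
    (1 + 2 * e) * (4 * r ^ 2 * e * d)).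
  { apply Rmult_le_compat; try apply Cmod_ge_0; [lra | exact IH]. }
  assert (A2 : r * Cmod (X - 1) * d <= r * e * d).
  { apply Rmult_le_compat_r; [exact D|]; now apply Rmult_le_compat_l. }
  assert (A3 : d * Cmod (Y ^ k - 1) <= d * (2 * r * e)) by now apply Rmult_le_compat_l.
  assert (A4 : r * e * (8 * (r * e * d)) <= / 8 * (8 * (r * e * d))).
  { apply Rmult_le_compat_r; [|lra]; repeat apply Rmult_le_pos; lra. }
  assert (A5 : 0 <= r * e * d) by (repeat apply Rmult_le_pos; lra).
  assert (A6 : 0 <= e * d) by (repeat apply Rmult_le_pos; lra).
  nra.
Qed.

Lemma Cpow_inj_near_1 (N : nat) (X Y : C) : (0 < N)%nat ->
  Cmod (X - 1) <= / (8 * INR N) -> Cmod (Y - 1) <= / (8 * INR N) ->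
  (X ^ N = Y ^ N)%C -> X = Y.
Proof.
intros HN HX HY E; apply lt_INR in HN; simpl in HN.
(* With [e = 1 / (8 N)] the Lipschitz constant [4 N^2 e] is [N / 2]. Equal powers then give
   [N |X - Y| <= (N / 2) |X - Y|]. *)
assert (H := Cpow_minus_near_1 X Y _ HX HY N
  ltac:(right; field; lra)).
rewrite E in H.
replace (Y ^ N - Y ^ N - INR N * (X - Y))%C with (- (INR N * (X - Y)))%C in H by ring.
rewrite Cmod_opp, Cmod_mult, Cmod_R, Rabs_pos_eq in H by lra.
replace (4 * INR N ^ 2 * / (8 * INR N)) with (INR N / 2) in H by (field; lra).
assert (D := Cmod_ge_0 (X - Y)).
assert (D0 : Cmod (X - Y) = 0) by nra.
apply Cmod_eq_0 in D0.
replace X with (X - Y + Y)%C by ring; rewrite D0; ring.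
Qed.

Lemma is_linear_Hinf_eval (x : l2) : open_unit_ball x ->
  is_linear (U := Hinf_NormedModule l2_NormedModule C_NormedModule)
    (V := C_NormedModule) (fun u : Hinf_scalar => u x).
Proof.
intros Hx; split; [reflexivity | reflexivity |].
exists 1; split; [lra|]; intros u; rewrite Rmult_1_l; now apply Hinf_norm_ge.
Qed.

(** A zero [y] of the functional is approached by [y + t x0] with [t > 0], where the functional
    equals [t]; continuity of [u - v] along this line does the rest. *)
Lemma Hinf_eq_off_zeros (u v : Hinf_scalar) (x0 : l2) : l2_norm x0 = 1 ->
  (forall y, open_unit_ball y -> l2_inner y x0 <> 0%C -> u y = v y) -> u = v.
Proof.
intros Hx0 H; apply Hinf_ext; intros y Hy.
destruct (Ceq_dec (l2_inner y x0) 0%C) as [E|E]; [|now apply H].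
set (D := fun w : C => (u (l2_plus y (l2_scal w x0)) + - v (l2_plus y (l2_scal w x0)))%C).
assert (D0 : D 0%C = (u y + - v y)%C).
{ unfold D; replace (l2_plus y (l2_scal 0 x0)) with y; [reflexivity|].
  apply l2_ext; intros j; simpl; ring. }
assert (HD : C_diff D 0%C).
{ assert (HL : ex_filterdiff (U := C_NormedModule) (V := l2_NormedModule)
    (fun w : C => l2_plus y (l2_scal w x0)) (locally (RtoC 0))).
  { eexists; apply (filterdiff_plus_fct (V := l2_NormedModule)).
    - apply filterdiff_const.
    - apply filterdiff_linear, (is_linear_scal_vector (V := l2_NormedModule) x0). }
  assert (HB : l2_plus y (l2_scal 0 x0) = y) by (apply l2_ext; intros j; simpl; ring).
  apply (ex_filterdiff_Cplus (V := C_NormedModule)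
    (fun w => u (l2_plus y (l2_scal w x0)))
    (fun w => - v (l2_plus y (l2_scal w x0)))%C).
  - apply (ex_filterdiff_comp' (U := C_NormedModule) (V := l2_NormedModule)
      (W := C_NormedModule) (fun w : C => l2_plus y (l2_scal w x0)) u _ HL).
    apply (Hinf_holo u); now rewrite HB.
  - destruct (ex_filterdiff_comp' (U := C_NormedModule) (V := l2_NormedModule)
      (W := C_NormedModule) (fun w : C => l2_plus y (l2_scal w x0)) v (RtoC 0) HL) as [l Hl].
    { apply (Hinf_holo v); now rewrite HB. }
    eexists; exact (filterdiff_opp_fct (V := C_NormedModule) _ _ Hl). }
assert (Z : Cmod (D 0%C) = 0).
{ apply Rle_antisym; [|apply Cmod_ge_0]; apply le_epsilon; intros eps He.
  destruct (C_diff_cont D 0%C HD eps He) as [d [Hd Hd']].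
  assert (Hy' : l2_norm y < 1) by exact Hy.
  set (t := Rmin (d / 2) ((1 - l2_norm y) / 2)).
  assert (Ht : 0 < t) by (apply Rmin_pos; lra).
  assert (Ht1 : t <= d / 2) by apply Rmin_l.
  assert (Ht2 : t <= (1 - l2_norm y) / 2) by apply Rmin_r.
  specialize (Hd' (RtoC t)).
  assert (Et : D (RtoC t) = 0%C).
  { unfold D; rewrite H; [ring | |].
    - eapply Rle_lt_trans; [apply l2_norm_triangle|].
      assert (S := l2_norm_scal (RtoC t) x0).
      rewrite Hx0, Cmod_R, Rabs_pos_eq in S by lra; simpl in *; lra.
    - rewrite l2_inner_plus_l, l2_inner_scal_l, E, l2_inner_self, Hx0.
      intros H'; replace (0 + t * RtoC (1 ^ 2))%C with (RtoC t) in H'.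
      + apply RtoC_inj in H'; lra.
      + replace (1 ^ 2) with 1 by ring; ring. }
  rewrite Et in Hd'.
  replace (0 - D 0)%C with (- D 0)%C in Hd' by ring; rewrite Cmod_opp in Hd'.
  rewrite Rplus_0_l; apply Hd'.
  replace (t - 0)%C with (RtoC t) by ring; rewrite Cmod_R, Rabs_pos_eq; lra. }
apply Cmod_eq_0 in Z; rewrite D0 in Z.
assert (Q : forall p q : C, (p + - q = 0)%C -> p = q).
{ intros p q Hpq; replace p with (p + - q + q)%C by ring; rewrite Hpq; ring. }
exact (Q _ _ Z).
Qed.

(** * The room left by the kernel vector *)

Lemma norm_invariant_map_le (g : Hinf_l2)
    (h1 : l2_norm (g l2_zero) + Hinf_norm (minus g (Hinf_const (g l2_zero))) <= 1)
    (P : l2 -> l2) (HP : is_linear P) (Hop : Rbar_le (op_norm P) 1)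
    (gP : forall y : l2, open_unit_ball y -> g y = g (P y))
    (x0 : l2) (Hx0 : l2_norm x0 = 1) (Px0 : P x0 = l2_zero)
    (y : l2) (Hy : open_unit_ball y) :
  l2_norm (g y) <=
  1 - (1 - l2_norm (g l2_zero)) * Cmod (l2_inner y x0) ^ 2 / 4.
Proof.
set (a := l2_norm (g l2_zero)) in *.
set (h := minus g (Hinf_const (g l2_zero)) : Hinf_l2) in *.
set (t := Cmod (l2_inner y x0) ^ 2).
assert (Hy' : l2_norm y < 1) by exact Hy.
assert (Hy0 := l2_norm_ge_0 y).
assert (Ht : 0 <= t) by apply pow2_ge_0.
set (z := minus y (scal (l2_inner y x0) x0) : l2).
assert (Hz : l2_norm z ^ 2 = l2_norm y ^ 2 - t) by now apply l2_norm_minus_proj.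
assert (Pz : P y = P z).
{ unfold z, minus; rewrite (linear_plus P HP), (linear_opp P _ HP).
  rewrite (linear_scal P HP), Px0.
  apply l2_ext; intros j; simpl; ring. }
assert (Cz := op_norm_contraction P HP Hop z); rewrite <- Pz in Cz.
set (p := l2_norm (P y)) in *.
assert (Hp : 0 <= p) by apply l2_norm_ge_0.
assert (Hp2 : p ^ 2 <= 1 - t).
{ assert (p ^ 2 <= l2_norm z ^ 2) by (apply pow_incr; lra). nra. }
assert (Ht1 : t <= 1) by (assert (Q := pow2_ge_0 p); lra).
assert (Bp : l2_norm (P y) < 1).
{ apply Rle_lt_trans with (2 := Hy').
  apply op_norm_contraction; assumption. }
assert (hE : forall w : l2, open_unit_ball w -> h w = minus (g w) (g l2_zero)).
{ intros w Hw; change (h w) with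
    (plus (g w) (opp (const_on_ball (V := l2_NormedModule) (g l2_zero) w))).
  now rewrite const_on_ball_in. }
assert (S := Hinf_weak_schwarz h (P y)).
fold p in S; set (H := Hinf_norm h) in *.
assert (h0 : h l2_zero = l2_zero).
{ rewrite hE by apply (zero_in_ball (V := l2_NormedModule)).
  exact (minus_eq_zero (G := l2_AbelianGroup) (g l2_zero)). }
specialize (S h0 Bp).
assert (HH : 0 <= H).
{ eapply Rle_trans; [apply l2_norm_ge_0|].
  exact (Hinf_norm_ge h _ (zero_in_ball (V := l2_NormedModule))). }
(* The 1/4 is Bernoulli's inequality: [p^2 <= 1 - t <= (1 - t/4)^4] gives [p <= (1 - t/4)^2], and
   the weak Schwarz lemma takes one more square root. Hypothesis [h1] gives [H <= 1 - a]. *)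
assert (B : l2_norm (h (P y)) <= (1 - t / 4) * (1 - a)).
{ apply Rsqr_incr_0_var; [|apply Rmult_le_pos; lra].
  rewrite !Rsqr_pow2; eapply Rle_trans; [exact S|].
  rewrite Rpow_mult_distr; apply Rmult_le_compat; [lra | apply pow2_ge_0 | |].
  - apply Rsqr_incr_0_var; [|apply pow2_ge_0]; rewrite !Rsqr_pow2; nra.
  - apply pow_incr; lra. }
rewrite hE in B by exact Bp.
rewrite (gP y Hy).
replace (g (P y)) with (l2_plus (minus (g (P y)) (g l2_zero)) (g l2_zero)).
- eapply Rle_trans; [apply l2_norm_triangle|]; fold a; lra.
- apply l2_ext; intros j; simpl; ring.
Qed.

Lemma l2_norm_normalize (x : l2) : x <> l2_zero ->
  l2_norm (l2_scal (/ RtoC (l2_norm x))%C x) = 1.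
Proof.
intros Hx.
assert (X := l2_norm_ge_0 x); set (s := l2_norm x) in *.
assert (Hs0 : s <> 0) by (intros H; now apply Hx, l2_norm_eq_0).
assert (Hs : RtoC s <> 0%C) by (intros H; now apply RtoC_inj in H).
set (e := l2_scal (/ RtoC s)%C x).
apply Rle_antisym.
- eapply Rle_trans; [apply l2_norm_scal|].
  rewrite Cmod_inv, Cmod_R, Rabs_pos_eq by (exact Hs || lra).
  fold s; right; field; exact Hs0.
- assert (Ex : x = l2_scal s e) by (apply l2_ext; intros j; simpl; field; exact Hs).
  assert (H := l2_norm_scal s e); rewrite <- Ex, Cmod_R, Rabs_pos_eq in H by exact X.
  fold s in H; apply Rmult_le_reg_l with s; lra.
Qed.

Theorem proposition3p4 (N : nat) (hN : (2 <= N)%nat)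
    (f0 : l2 -> C) (hf0 : Au f0)
    (f0E : forall x : l2, open_unit_ball x ->
       f0 x = CSeries (fun j => (x j ^ N)%C))
    (g : Hinf_l2) (g_norm : norm g = 1)
    (g_ball : forall y : l2, open_unit_ball y -> open_unit_ball (g y))
    (h1 : norm (g zero) + norm (minus g (Hinf_const (g zero))) <= 1)
    (h2 : exists P : l2 -> l2,
       is_linear P /\ Rbar_le (op_norm P) 1 /\
       (exists x : l2, x <> zero /\ P x = zero) /\
       (forall y : l2, open_unit_ball y -> g y = g (P y))) :
  contains_analytic_copy (cluster_set f0 g)
    (open_unit_ball (V := Hinf_NormedModule l2_NormedModule C_NormedModule)).
Proof.
destruct h2 as [P [HP [Hop [[x [Hx Px]] gP]]]].
set (x0 := l2_scal (/ RtoC (l2_norm x))%C x).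
assert (Hx0 : l2_norm x0 = 1) by now apply l2_norm_normalize.
assert (Px0 : P x0 = l2_zero).
{ change x0 with (scal (/ RtoC (l2_norm x) : C_AbsRing)%C x).
  rewrite (linear_scal P HP), Px; apply (scal_zero_r (V := l2_NormedModule)). }
set (a := l2_norm (g l2_zero)).
assert (Ha : 0 <= a < 1).
{ split; [apply l2_norm_ge_0|].
  exact (g_ball _ (zero_in_ball (V := l2_NormedModule))). }
assert (gle := norm_invariant_map_le g h1 P HP Hop gP x0 Hx0 Px0); fold a in gle.
set (phi := fun y => l2_inner y x0).
assert (phile : forall y : l2, open_unit_ball y -> Cmod (phi y) <= 1).
{ intros y Hy; eapply Rle_trans; [apply l2_inner_le|].
  rewrite Hx0, Rmult_1_r; left; exact Hy. }
(* The radius around 1 on which [Cpow_inj_near_1] applies. *)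
set (eps := / (8 * INR N)).
assert (HN : 2 <= INR N) by (apply le_INR in hN; simpl in hN; lra).
assert (Heps : 0 < eps <= 1).
{ unfold eps; split; [apply Rinv_0_lt_compat; lra|].
  rewrite <- Rinv_1; apply Rinv_le_contravar; lra. }
(* As [|1 + eps u| <= 2], this gives [|c|^2 <= (1 - a)^2 |phi|^2 / 4], which fits into the gap
   [(1 - a) |phi|^2 / 4] because [1 - a <= 1]. *)
set (eta := (1 - a) / 4).
assert (Heta : 0 < eta) by (unfold eta; lra).
set (c := fun (u : Hinf_scalar) (y : l2) => (eta * phi y * (1 + eps * u y))%C).
assert (u_near_1 : forall (u : Hinf_scalar) y, open_unit_ball u -> open_unit_ball y ->
  Cmod (1 + eps * u y - 1) <= eps).
{ intros u y Hu Hy; replace (1 + eps * u y - 1)%C with (eps * u y)%C by ring.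
  rewrite Cmod_mult, Cmod_R, Rabs_pos_eq by lra.
  assert (B : Cmod (u y) <= 1).
  { apply Rle_trans with (1 := Hinf_norm_ge u y Hy); left; exact Hu. }
  nra. }
assert (c_holo : forall u, holomorphic_on (V := l2_NormedModule)
  (W := C_NormedModule) open_unit_ball (c u)).
{ intros u y Hy.
  apply (ex_filterdiff_Cmult (fun y => eta * phi y)%C (fun y => 1 + eps * u y)%C).
  - apply (ex_filterdiff_Cmult (fun _ => RtoC eta) phi); [apply ex_filterdiff_Cconst|].
    apply ex_filterdiff_is_linear, is_linear_l2_inner.
  - apply (ex_filterdiff_Cplus (fun _ => RtoC 1) (fun y => eps * u y)%C);
      [apply ex_filterdiff_Cconst|].
    apply (ex_filterdiff_Cmult (fun _ => RtoC eps) u); [apply ex_filterdiff_Cconst|].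
    exact (Hinf_holo u y Hy). }
assert (gc : forall u, open_unit_ball u -> forall y : l2, open_unit_ball y ->
  l2_norm (g y) ^ 2 + Cmod (c u y) ^ 2 <= 1).
{ intros u Hu y Hy; unfold c.
  rewrite !Cmod_mult, Cmod_R, Rabs_pos_eq by lra.
  assert (T := Cmod_triangle (1 + eps * u y - 1) 1).
  replace (1 + eps * u y - 1 + 1)%C with (1 + eps * u y)%C in T by ring.
  rewrite Cmod_1 in T; specialize (u_near_1 u y Hu Hy).
  assert (G0 := l2_norm_ge_0 (g y)).
  assert (G1 : l2_norm (g y) < 1) by exact (g_ball y Hy).
  specialize (gle y Hy); change (l2_inner y x0) with (phi y) in gle.
  set (t := Cmod (phi y)) in *.
  assert (K0 := Cmod_ge_0 (1 + eps * u y)); set (K := Cmod (1 + eps * u y)) in *.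
  assert (K2 : K ^ 2 <= 4) by nra.
  assert (T2 : 0 <= (eta * t) ^ 2) by apply pow2_ge_0.
  assert (T3 : 0 <= t ^ 2) by apply pow2_ge_0.
  replace ((eta * t * K) ^ 2) with ((eta * t) ^ 2 * K ^ 2) by ring.
  (* [|g y|^2 <= |g y|], so the linear bound [gle] on the norm can be used directly. *)
  apply Rle_trans with (l2_norm (g y) + (eta * t) ^ 2 * 4); [nra|].
  assert ((eta * t) ^ 2 * 4 = (1 - a) ^ 2 * t ^ 2 / 4) by (unfold eta; field).
  assert ((1 - a) ^ 2 * t ^ 2 <= (1 - a) * t ^ 2) by nra.
  lra. }
set (F := fun (u : Hinf_scalar) (y : l2) => (f0 (g y) + c u y ^ N)%C).
assert (F_holo : forall u, holomorphic_on (V := l2_NormedModule)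
  (W := C_NormedModule) open_unit_ball (F u)).
{ intros u y Hy.
  apply (ex_filterdiff_Cplus (fun y => f0 (g y)) (fun y => c u y ^ N)%C).
  - apply (ex_filterdiff_comp' (U := l2_NormedModule) (V := l2_NormedModule)
      (W := C_NormedModule) g f0); [exact (Hinf_holo g y Hy)|].
    exact (proj1 hf0 _ (g_ball y Hy)).
  - apply ex_filterdiff_Cpow, c_holo, Hy. }
(* The embedding is a total function, so boundedness is shown for every [u], with a bound depending
   on [u]. *)
assert (F_bounded : forall u, exists M : R, forall y : l2_NormedModule,
  open_unit_ball y -> norm (F u y : C_NormedModule) <= M).
{ intros u; destruct (Hinf_bounded u) as [M HM].
  exists (2 + (eta * 1 * (1 + eps * M)) ^ N); intros y Hy.
  change (Cmod (F u y) <= 2 + (eta * 1 * (1 + eps * M)) ^ N).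
  unfold F; eapply Rle_trans; [apply Cmod_triangle|].
  apply Rplus_le_compat.
  - rewrite f0E by now apply g_ball.
    apply l2_pow_sum_le; [exact hN | left; exact (g_ball y Hy)].
  - rewrite Cmod_pow; apply pow_incr; split; [apply Cmod_ge_0|].
    unfold c; rewrite !Cmod_mult, Cmod_R, Rabs_pos_eq by lra.
    apply Rmult_le_compat; [| apply Cmod_ge_0 | |].
    + apply Rmult_le_pos; [lra | apply Cmod_ge_0].
    + apply Rmult_le_compat_l; [lra | now apply phile].
    + eapply Rle_trans; [apply Cmod_triangle|].
      rewrite Cmod_1, Cmod_mult, Cmod_R, Rabs_pos_eq by lra.
      apply Rplus_le_compat_l, Rmult_le_compat_l; [lra | exact (HM y Hy)]. }
set (FF := fun u => Hinf_of (V := l2_NormedModule) (W := C_NormedModule)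
  (F u) (F_holo u) (F_bounded u) : Hinf_scalar).
assert (FFE : forall u y, open_unit_ball y -> FF u y = F u y).
{ intros u y Hy; exact (restrict_in (V := l2_NormedModule) (W := C_NormedModule) (F u) y Hy). }
exists FF; split; [|split].
- intros u Hu; apply (cluster_set_perturb N hN f0 f0E g g_ball (c u) (c_holo u) (gc u Hu)).
  exact (FFE u).
(* Off the zeros of [phi] the factor [(eta phi y)^N] cancels, which leaves equal [N]-th powers of
   two numbers within [eps] of 1. *)
- intros u v Hu Hv Huv; apply (Hinf_eq_off_zeros u v x0 Hx0); intros y Hy Hphi.
  assert (E := f_equal (fun w : Hinf_scalar => w y) Huv); cbv beta in E.
  rewrite !FFE in E by exact Hy; unfold F, c in E.
  rewrite !(Cpow_mult_l (eta * phi y)) in E.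
  assert (Heta0 : RtoC eta <> 0%C) by (intros H; apply RtoC_inj in H; lra).
  assert (Hk : ((eta * phi y) ^ N <> 0)%C).
  { apply Cpow_nz, Cmult_neq_0; [exact Heta0 | exact Hphi]. }
  set (k := ((eta * phi y) ^ N)%C) in *.
  set (X := (1 + eps * u y)%C) in *; set (Y := (1 + eps * v y)%C) in *.
  assert (EXY : (X ^ N = Y ^ N)%C).
  { replace (X ^ N)%C with (/ k * (f0 (g y) + k * X ^ N - f0 (g y)))%C
      by (field; exact Hk).
    rewrite E; field; exact Hk. }
  apply Cpow_inj_near_1 in EXY; [|lia | exact (u_near_1 u y Hu Hy) | exact (u_near_1 v y Hv Hy)].
  assert (Heps0 : RtoC eps <> 0%C) by (intros H; apply RtoC_inj in H; lra).
  assert (Q : forall p q : C, (1 + eps * p = 1 + eps * q)%C -> p = q).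
  { intros p q Hpq; replace p with (/ eps * (1 + eps * p - 1))%C by (field; exact Heps0).
    rewrite Hpq; field; exact Heps0. }
  exact (Q _ _ EXY).
(* For fixed [y] the value is a polynomial in the bounded linear functional that evaluates [u] at
   [y]. *)
- intros y Hy u Hu.
  apply (ex_filterdiff_ext (U := Hinf_NormedModule l2_NormedModule C_NormedModule)
    (V := C_NormedModule) (fun u : Hinf_scalar => F u y)).
  { intros v; symmetry; now apply FFE. }
  apply (ex_filterdiff_Cplus (fun _ => f0 (g y)) (fun u => c u y ^ N)%C);
    [apply ex_filterdiff_Cconst|].
  apply ex_filterdiff_Cpow.
  apply (ex_filterdiff_Cmult (fun _ => eta * phi y)%C
    (fun u : Hinf_scalar => 1 + eps * u y)%C); [apply ex_filterdiff_Cconst|].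
  apply (ex_filterdiff_Cplus (fun _ => RtoC 1) (fun u : Hinf_scalar => eps * u y)%C);
    [apply ex_filterdiff_Cconst|].
  apply (ex_filterdiff_Cmult (fun _ => RtoC eps) (fun u : Hinf_scalar => u y));
    [apply ex_filterdiff_Cconst|].
  apply ex_filterdiff_is_linear, is_linear_Hinf_eval, Hy.
Qed.
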